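(* Let $\Gamma$ be a discrete group containing a copy of a noncommutative free group. Then $B_{\ell^p}(\Gamma)$ is distinct for every $p\in[2,\infty)$, i.e. $B_{\ell^p}(\Gamma)\ne B_{\ell^q}(\Gamma)$ whenever $p,q\in[2,\infty)$, $p\neq q$. Hence, $A_{\ell^p}(\Gamma)$ is also distinct for every $p\in[2,\infty)$, i.e. $A_{\ell^p}(\Gamma)\ne A_{\ell^q}(\Gamma)$ whenever $p,q\in[2,\infty)$, $p\neq q$.
   Context: Let $\Gamma$ be a discrete group. For a unitary representation $\pi:\Gamma\to B(\mathcal{H}_\pi)$ and $x,y\in\mathcal{H}_\pi$ write $\pi_{x,y}(s)=\langle\pi(s)x,y\rangle$. The Fourier-Stieltjes algebra $B(\Gamma)$ is the set of all such coefficient functions, identified with the dual of the full group $C^*$-algebra $C^*(\Gamma)$ via $\langle u,f\rangle=\sum_{s\in\Gamma}u(s)f(s)$ for $f\in\ell^1(\Gamma)$. For $1\le p<\infty$, $\pi$ is an $\ell^p$-representation if there is a dense subspace $\mathcal{H}_0\subset\mathcal{H}_\pi$ with $\pi_{x,x}\in\ell^p(\Gamma)$ for every $x\in\mathcal{H}_0$. Put $A_{\ell^p}(\Gamma)=\{\pi_{x,y}:\pi\text{ an }\ell^p\text{-representation of }\Gamma,\ x,y\in\mathcal{H}_\pi\}\subset B(\Gamma)$, and let $B_{\ell^p}(\Gamma)$ be the closure of $A_{\ell^p}(\Gamma)$ in the weak*-topology $\sigma(B(\Gamma),C^*(\Gamma))$. *)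

(* Defs.v *)
From HB Require Import structures.
From mathcomp Require Import all_boot all_order all_algebra.
From mathcomp Require Import finmap sesquilinear.
From mathcomp Require Import complex.
From mathcomp Require Import all_classical all_reals all_analysis.
From mathcomp.analysis.showcase Require Import summability.

Set Implicit Arguments.
Unset Strict Implicit.
Unset Printing Implicit Defensive.

Import Order.TTheory GRing.Theory Num.Theory.
Import numFieldNormedType.Exports.

Local Open Scope classical_set_scope.
Local Open Scope ring_scope.

(* [F] is free on the family [iota], in the sense of the universal property. *)
Definition is_free_group (S : Type) (F : groupType) (iota : S -> F) : Prop :=
  forall (G : groupType) (f : S -> G),
  exists2 phi : {multiplicative F -> G},
    (forall s, phi (iota s) = f s) &
    (forall psi : {multiplicative F -> G},
       (forall s, psi (iota s) = f s) -> psi =1 phi).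

Definition contains_noncommutative_free_group (Gamma : groupType) : Prop :=
  exists (S : Type) (F : groupType) (iota : S -> F)
         (phi : {multiplicative F -> Gamma}),
    [/\ is_free_group iota, (exists x y : F, ~ commute x y) & injective phi].

(* Inner products are linear in the first variable and conjugate-linear in the
   second one. *)
Record hilbert (R : realType) := Hilbert {
  hilbert_space :> completeNormedModType R[i];
  inner : {dot hilbert_space for @Num.conj R[i]};
  inner_norm : forall x, inner x x = `|x| ^+ 2 }.

(* Norms in an [R[i]]-module take their values in [R[i]]; this is the same
   norm, as an element of [R]. *)
Definition rnorm (R : realType) (V : normedModType R[i]) (x : V) : R :=
  complex.Re `|x|.

Section FourierStieltjes.
Context {R : realType} (Gamma : groupType).
Implicit Types (H : hilbert R) (p : R) (u f : Gamma -> R[i]).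

Record unitary_rep (H : hilbert R) := UnitaryRep {
  urep :> Gamma -> {linear H -> H};
  urep1 : forall x, urep 1%g x = x;
  urepM : forall s t x, urep (s * t)%g x = urep s (urep t x);
  urep_unitary : forall s x y, inner H (urep s x) (urep s y) = inner H x y }.

Definition coef H (pi : unitary_rep H) (x y : H) : Gamma -> R[i] :=
  fun s => inner H (pi s x) y.

Definition FS : set (Gamma -> R[i]) :=
  [set u | exists (H : hilbert R) (pi : unitary_rep H) (x y : H),
             u = coef pi x y].

Definition lp p : set (Gamma -> R[i]) :=
  [set f | (\esum_(s in [set: Gamma]) (rnorm (f s : R[i]^o) `^ p)%:E < +oo)%E].

Definition is_lp_rep p H (pi : unitary_rep H) : Prop :=
  exists H0 : set H,
    [/\ H0 0,
        forall (a : R[i]) x y, H0 x -> H0 y -> H0 (a *: x + y),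
        dense H0 &
        forall x, H0 x -> lp p (coef pi x x)].

Definition A_lp p : set (Gamma -> R[i]) :=
  [set u | exists (H : hilbert R) (pi : unitary_rep H) (x y : H),
             is_lp_rep p pi /\ u = coef pi x y].

(* For [f] in l^1, the operator [\sum_s f(s) pi(s)]; [sum] is the limit of the
   net of finite partial sums. *)
Definition integrated H (pi : unitary_rep H) f (x : H) : H :=
  sum (fun s => f s *: pi s x).

Definition opnorm H (T : H -> H) : \bar R :=
  ereal_sup [set (rnorm (T x))%:E | x in [set x : H | rnorm x <= 1]].

Definition cstar_norm f : \bar R :=
  ereal_sup [set e | exists (H : hilbert R) (pi : unitary_rep H),
                       e = opnorm (integrated pi f)].

(* The full group C*-algebra is the completion of l^1 for [cstar_norm]; its
   elements are given here by Cauchy sequences in l^1. Sequences are not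
   identified when their difference tends to 0: such sequences have the same
   [pairing] with every element of [FS], so the weak* topology below is the
   same. *)
Record cstar := Cstar {
  cstar_seq :> nat -> Gamma -> R[i];
  cstar_l1 : forall n, lp 1 (cstar_seq n);
  cstar_cauchy : forall e : R, 0 < e -> exists N : nat,
    forall m n, (N <= m)%N -> (N <= n)%N ->
      (cstar_norm (fun s => cstar_seq m s - cstar_seq n s)%R < e%:E)%E }.

Definition pairing_l1 u f : R[i]^o := sum (fun s => u s * f s : R[i]^o).

Definition pairing u (a : cstar) : R[i]^o :=
  lim (pairing_l1 u (a n) @[n --> \oo]).

(* Topology of pointwise convergence on [cstar]. Only its trace on [FS] is
   meaningful: [pairing] is the duality between [FS] and the C*-algebra, and
   has no meaning outside [FS]. *)
Definition weak_star : Type :=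
  initial_topology (pairing : (Gamma -> R[i]) -> {ptws cstar -> R[i]^o}).

Definition B_lp p : set (Gamma -> R[i]) :=
  FS `&` closure (A_lp p : set weak_star).

End FourierStieltjes.

Arguments FS {R} Gamma.
Arguments lp {R} Gamma p.
Arguments A_lp {R} Gamma p.
Arguments cstar {R} Gamma.
Arguments pairing {R Gamma} u a.
Arguments weak_star {R} Gamma.
Arguments B_lp {R} Gamma p.

(* Main.v *)
(** Let T be the average of N free generators of Gamma and their inverses, and d = 2N.
  In an l^p-representation the diagonal coefficients of a dense set of vectors
  are in l^p; the adjacency operator of the d-regular tree has norm at most
  2 d^(1-1/p) on l^p, so the moments of T grow at most like those of
  rho = 2 d^(-1/p), and T has norm at most rho. For r < d^(-1/q) the function
  r^|x| on the free group, extended by 0 to Gamma, is a coefficient of an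
  l^q-representation, in which T has norm at least r. If p < q then, for N
  large, one can choose rho < c < r. The element Y + |Y| of C*(Gamma), with
  Y = (T^2 - c^2)/2, then annihilates every l^p-representation, hence the
  weak*-closure of A_{l^p}, but not r^|x|. *)
From HB Require Import structures.
Require Import Defs.
From mathcomp Require Import all_boot all_order all_algebra.
From mathcomp Require Import finmap sesquilinear complex.
From mathcomp Require Import all_classical all_reals all_analysis.
From mathcomp.analysis.showcase Require Import summability.
From mathcomp Require Import ring lra.

Set Implicit Arguments.
Unset Strict Implicit.
Unset Printing Implicit Defensive.

Import Order.TTheory GRing.Theory Num.Theory.
Import numFieldNormedType.Exports.

Local Open Scope classical_set_scope.
Local Open Scope ring_scope.

#[local] Existing Instance totally_filter.

(** The weak-star closure puts no bound on norms, so a mere smallness estimate for pairings with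
    [A_lp p] would not survive the passage to limits: the separating element has to annihilate
    [A_lp p] exactly. This is why a function of T vanishing below c is used, namely Y + |Y|, twice
    the positive part of Y; it vanishes when T has norm less than c and has a positive quadratic
    form at any vector that T stretches by more than c. To have |Y| as a limit of elements of the
    group algebra, it is computed by a polynomial iteration. A scalar sequence controls this
    iteration in all unitary representations at once, which gives a Cauchy sequence for the C*-norm.

    The factor 2 in rho is the price of separating the parent of a vertex from its children. The
    requirement rho < r < d^(-1/q) forces d^(1/p-1/q) > 2, hence the many generators, which are
    manufactured from two free letters. The l^p estimate is made on Gamma itself, where the left
    orbits of the free subgroup are disjoint trees. *)

Lemma expr_unbounded (R : realType) (C t : R) : 1 < t -> exists n, C < t ^+ n.
Proof.
move=> t1; exists (Num.bound `|C / (t - 1)|).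
set n := Num.bound _.
have Bernoulli k : k%:R * (t - 1) <= t ^+ k.
  elim: k => [|k IH]; first by rewrite mul0r ler01.
  have tk : 1 <= t ^+ k by rewrite exprn_ege1// ltW.
  by rewrite exprS -addn1 natrD; nra.
apply: lt_le_trans (Bernoulli n).
by rewrite -ltr_pdivrMr ?subr_gt0// (le_lt_trans (ler_norm _))// archi_boundP.
Qed.

Lemma complexRe_conj (R : realType) (z : R[i]) : complex.Re (Num.conj z) = complex.Re z.
Proof. by case: z. Qed.

(** * Bounded finite sums *)

Section BoundedSums.
Context {R : realType} {I : choiceType}.
Implicit Types (f g : I -> R) (s : seq I) (M : R).

(** For nonnegative [f] this is summability with sum at most [M], stated inside [R] and with an
    explicit constant that can be followed through the estimates. *)
Definition sums_le f M := forall s, uniq s -> \sum_(i <- s) f i <= M.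

Definition total f : R := sup [set \sum_(i <- s) f i | s in [set s | uniq s]].

Lemma sums_le_ge0 f M : sums_le f M -> 0 <= M.
Proof. by move=> /(_ [::] isT); rewrite big_nil. Qed.

Lemma le_sums_le f g M : (forall i, f i <= g i) -> sums_le g M -> sums_le f M.
Proof. by move=> fg gM s us; apply: le_trans (gM s us); apply: ler_sum. Qed.

Lemma le_sums f M M' : M <= M' -> sums_le f M -> sums_le f M'.
Proof. by move=> MM' fM s us; apply: le_trans MM'; apply: fM. Qed.

Lemma sums_leD f g M M' :
  sums_le f M -> sums_le g M' -> sums_le (fun i => f i + g i) (M + M').
Proof. by move=> fM gM s us; rewrite big_split lerD ?fM ?gM. Qed.

Lemma sums_leZ f M a : 0 <= a -> sums_le f M -> sums_le (fun i => a * f i) (a * M).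
Proof. by move=> a0 fM s us; rewrite -mulr_sumr ler_wpM2l ?fM. Qed.

Lemma sums_le_sum (J : finType) (F : J -> I -> R) (M : J -> R) :
  (forall j, sums_le (F j) (M j)) -> sums_le (fun i => \sum_j F j i) (\sum_j M j).
Proof.
by move=> FM s us; rewrite exchange_big; apply: ler_sum => j _; apply: FM.
Qed.

Lemma ler_sum_uniq (f : I -> R) s1 s2 : (forall i, 0 <= f i) -> uniq s1 -> uniq s2 ->
  {subset s1 <= s2} -> \sum_(i <- s1) f i <= \sum_(i <- s2) f i.
Proof.
move=> f0 u1 u2 s12.
have e : perm_eq s1 [seq i <- s2 | i \in s1].
  apply: uniq_perm; rewrite ?filter_uniq// => i; rewrite mem_filter.
  by case: (boolP (i \in s1)) => // /s12 ->.
rewrite (perm_big _ e) big_filter [leRHS](bigID (mem s1))/=.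
by rewrite lerDl sumr_ge0.
Qed.

Lemma total_ub f M : sums_le f M -> sums_le f (total f).
Proof.
move=> fM s us; apply: sup_upper_bound; last by exists s.
by split; [exists (\sum_(i <- s) f i); exists s|exists M => _ [t ut <-]; exact: fM].
Qed.

Lemma total_le f M : sums_le f M -> total f <= M.
Proof.
move=> fM; apply: ge_sup; last by move=> _ [t ut <-]; exact: fM.
by exists 0; exists [::] => //; rewrite big_nil.
Qed.

Lemma sums_le_term f M i : sums_le f M -> f i <= M.
Proof. by move=> /(_ [:: i] isT); rewrite big_seq1. Qed.

Lemma cvg_total f M : (forall i, 0 <= f i) -> sums_le f M ->
  partial_sum f @ totally --> total f.
Proof.
move=> f0 fM; apply/cvgrPdist_lt => e e0.
have [|_ [s us <-] sup_s] := sup_adherent e0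
    (_ : has_sup [set \sum_(i <- s) f i | s in [set s | uniq s]]).
  by split; [exists 0; exists [::] => //; rewrite big_nil|exists M => _ [t ut <-]; exact: fM].
exists [fset i in s]%fset => // B sB.
have -> : partial_sum f B = \sum_(i <- B) f i by rewrite big_seq_fsetE.
have tB := total_ub fM (fset_uniq B).
rewrite ger0_norm ?subr_ge0// ltrBlDr -ltrBlDl (lt_le_trans sup_s)//.
apply: ler_sum_uniq => // i si.
by apply: (fsubsetP sB); rewrite !inE.
Qed.

End BoundedSums.

Lemma sums_le_inj (R : realType) (I J : choiceType) (h : I -> J) (f : J -> R) M :
  injective h -> sums_le f M -> sums_le (fun i => f (h i)) M.
Proof. by move=> hI fM s us; rewrite -(big_map h xpredT f); apply: fM; rewrite map_inj_uniq. Qed.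

(** * The real inner product of a Hilbert space *)

Section RealNorm.
Context {R : realType} {V : normedModType R[i]}.
Implicit Types (x y : V) (a : R).

Lemma rnormE x : (rnorm x)%:C%C = `|x|.
Proof. by rewrite /rnorm RRe_real// normr_real. Qed.

Lemma rnorm_ge0 x : 0 <= rnorm x.
Proof. by rewrite -ler0c rnormE. Qed.

Lemma rnorm0 : rnorm (0 : V) = 0.
Proof. by rewrite /rnorm normr0. Qed.

Lemma rnorm_eq0 x : rnorm x = 0 -> x = 0.
Proof. by move=> x0; apply/eqP; rewrite -normr_eq0 -rnormE x0. Qed.

Lemma rnormN x : rnorm (- x) = rnorm x.
Proof. by rewrite /rnorm normrN. Qed.

Lemma rnormZ a x : rnorm (a%:C%C *: x) = `|a| * rnorm x.
Proof.
by apply: complexI; rewrite rmorphM/= !rnormE normrZ normc_def /= expr0n addr0 sqrtr_sqr.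
Qed.

Lemma ler_rnormD x y : rnorm (x + y) <= rnorm x + rnorm y.
Proof. by rewrite -lecR rmorphD/= !rnormE ler_normD. Qed.

Lemma ler_rnormB x y : rnorm (x - y) <= rnorm x + rnorm y.
Proof. by rewrite (le_trans (ler_rnormD _ _))// rnormN. Qed.

Lemma ler_rnorm_sum (I : Type) (s : seq I) (F : I -> V) :
  rnorm (\sum_(i <- s) F i) <= \sum_(i <- s) rnorm (F i).
Proof.
elim/big_rec2: _ => [|i a x _ xa]; first by rewrite rnorm0.
by rewrite (le_trans (ler_rnormD _ _))// lerD2l.
Qed.

End RealNorm.

Section RealInner.
Context {R : realType} (H : hilbert R).
Implicit Types (x y z : H) (a b : R).

(** The operators studied below have real coefficients, so the real inner product carries the
    spectral argument; [ip x ('i%C *: y)] recovers the imaginary part. *)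
Definition ip x y : R := complex.Re (inner H x y).

Lemma ipC x y : ip x y = ip y x.
Proof. by rewrite /ip hermC expr0 mul1r complexRe_conj. Qed.

Lemma ipDl x y z : ip (x + y) z = ip x z + ip y z.
Proof. by rewrite /ip linearDl raddfD. Qed.

Lemma ipZl a x y : ip (a%:C%C *: x) y = a * ip x y.
Proof. by rewrite /ip linearZl_LR /=; case: (inner H x y) => u v /=; ring. Qed.

Lemma ipDr x y z : ip z (x + y) = ip z x + ip z y.
Proof. by rewrite ipC ipDl !(ipC z). Qed.

Lemma ipZr a x y : ip y (a%:C%C *: x) = a * ip y x.
Proof. by rewrite ipC ipZl ipC. Qed.

Lemma ipNl x y : ip (- x) y = - ip x y.
Proof. by rewrite -scaleN1r -(rmorphN1 (real_complex R)) ipZl mulN1r. Qed.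

Lemma ipNr x y : ip y (- x) = - ip y x.
Proof. by rewrite ipC ipNl ipC. Qed.

Lemma ip0l x : ip 0 x = 0.
Proof. by rewrite -(subrr 0) ipDl ipNl subrr. Qed.

Lemma ip0r x : ip x 0 = 0.
Proof. by rewrite ipC ip0l. Qed.

Lemma ip_suml (I : Type) (s : seq I) (F : I -> H) y :
  ip (\sum_(i <- s) F i) y = \sum_(i <- s) ip (F i) y.
Proof.
by elim/big_ind2: _ => [|a b c d <- <-|]//; rewrite ?ip0l ?ipDl.
Qed.

Lemma ipxx x : ip x x = rnorm x ^+ 2.
Proof. by rewrite /ip inner_norm -rnormE -rmorphXn. Qed.

Lemma sqr_rnormD x y : rnorm (x + y) ^+ 2 = rnorm x ^+ 2 + 2 * ip x y + rnorm y ^+ 2.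
Proof. by rewrite -!ipxx ipDl !ipDr (ipC y x); ring. Qed.

Lemma sqr_rnormB x y : rnorm (x - y) ^+ 2 = rnorm x ^+ 2 - 2 * ip x y + rnorm y ^+ 2.
Proof. by rewrite sqr_rnormD rnormN ipNr; ring. Qed.

Lemma ip_CauchySchwarz x y : `|ip x y| <= rnorm x * rnorm y.
Proof.
have [y0|yN0] := eqVneq (rnorm y) 0.
  by rewrite (rnorm_eq0 y0) ip0r rnorm0 normr0 mulr0.
have Y : 0 < rnorm y ^+ 2 by rewrite exprn_gt0// lt_def yN0 rnorm_ge0.
rewrite -(@ler_pXn2r _ 2) ?nnegrE ?mulr_ge0 ?rnorm_ge0//.
rewrite real_normK ?num_real// -(ler_pM2l Y) -subr_ge0.
(* This vector is [rnorm y ^+ 2] times the component of [x] orthogonal to [y] for [ip]; the scaling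
   avoids a division. *)
have := sqr_ge0 (rnorm ((rnorm y ^+ 2)%:C%C *: x - (ip x y)%:C%C *: y)).
rewrite sqr_rnormB !rnormZ ipZl ipZr !exprMn !real_normK ?num_real//.
by congr (_ <= _); ring.
Qed.

Lemma inner_abs x y : `|complex.Im (inner H x y)| <= rnorm x * rnorm y.
Proof.
have -> : complex.Im (inner H x y) = ip x ('i%C *: y).
  rewrite /ip linearZr_LR /=; case: (inner H x y) => u v /=; ring.
rewrite (le_trans (ip_CauchySchwarz _ _))//.
have -> : rnorm ('i%C *: y) = rnorm y; last by [].
by rewrite /rnorm normrZ normc_def /= expr0n /= add0r expr1n sqrtr1 mul1r.
Qed.

End RealInner.

Section Adjoint.
Context {R : realType} (H : hilbert R) (T : H -> H).
Hypothesis T_sym : forall x y, ip (T x) y = ip x (T y).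
Implicit Types x y : H.

Lemma iter_sym n x y : ip (iter n T x) y = ip x (iter n T y).
Proof. by elim: n x y => // n IH x y; rewrite iterS T_sym IH -iterSr. Qed.

(* The moments [a n = |T^n x|^2] are log-convex, so the ratio
   [a n.+1 / a n] increases and an exponential bound on [a] bounds the first ratio. *)
Lemma sym_bound (rho C : R) x : 0 < rho ->
  (forall n, ip (iter n T x) x <= C * rho ^+ n) -> rnorm (T x) <= rho * rnorm x.
Proof.
move=> rho0 Cx.
pose a n := rnorm (iter n T x) ^+ 2.
(* By symmetry [a n] is the moment of order [2n]. *)
have aC n : a n <= C * (rho ^+ 2) ^+ n.
  rewrite /a -ipxx iter_sym -iterD ipC addnn -exprM mul2n; exact: Cx.
have a_ge0 n : 0 <= a n by exact: sqr_ge0.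
have acvx n : a n.+1 ^+ 2 <= a n * a n.+2.
  rewrite /a -ipxx iterS T_sym -iterS -exprMn.
  by rewrite -real_normK ?num_real// lerXn2r ?nnegrE ?mulr_ge0 ?rnorm_ge0// ip_CauchySchwarz.
rewrite -(@ler_pXn2r _ 2) ?nnegrE ?mulr_ge0 ?rnorm_ge0 ?(ltW rho0)// exprMn.
rewrite leNgt; apply/negP => lt1.
set s := rho ^+ 2 in aC lt1 *; have s0 : 0 < s by rewrite exprn_gt0.
have {}lt1 : s * a 0 < a 1 by [].
have a0 : 0 < a 0.
  rewrite lt_def a_ge0 andbT; apply/eqP => a00.
  have := acvx 0; rewrite a00 mul0r => h.
  have a1 : a 1 = 0 by apply/eqP; rewrite -sqrf_eq0 eq_le h sqr_ge0.
  by move: lt1; rewrite a1 a00 mulr0 ltxx.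
pose t := a 1 / a 0.
have st : s < t by rewrite /t ltr_pdivlMr.
have t0 : 0 < t by exact: lt_trans st.
have at_ n : 0 < a n /\ t * a n <= a n.+1.
  elim: n => [|n [an0 IH]]; first by rewrite a0 /t divfK// gt_eqF.
  have an1 : 0 < a n.+1 by rewrite (lt_le_trans _ IH)// mulr_gt0.
  split=> //; rewrite -(ler_pM2l an0) (le_trans _ (acvx n))//.
  by rewrite mulrA (mulrC (a n)) expr2 ler_pM2r.
have atn n : t ^+ n * a 0 <= a n.
  elim: n => [|n IH]; first by rewrite mul1r.
  by rewrite (le_trans _ (at_ n).2)// exprS -mulrA ler_pM2l.
have Cn n : (t / s) ^+ n <= C / a 0.
  rewrite ler_pdivlMr// expr_div_n mulrAC ler_pdivrMr ?exprn_gt0//.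
  exact: le_trans (atn n) (aC n).
have ts1 : 1 < t / s by rewrite ltr_pdivlMr// mul1r.
have [n] := expr_unbounded (C / a 0) ts1.
by rewrite ltNge Cn.
Qed.

End Adjoint.

(** * Reduced words and free families *)

Section Words.
Context (n : nat).

(** The boolean is the sign of the exponent. The index type is the ring Z/(n+2): it has at least two
    elements, and its addition moves the levels in [shift]. *)
Definition letter : Type := ('I_n.+2 * bool)%type.
HB.instance Definition _ := Finite.on letter.
Implicit Types (l : letter) (w z : seq letter).

Definition linv l : letter := (l.1, ~~ l.2).

Lemma linvK : involutive linv.
Proof. by case=> i b; rewrite /linv negbK. Qed.

(** Left multiplication by [l] on normal forms of the free group; for reduced [w], [foldr push w z]
    is the normal form of the product of [z] and [w]. *)
Definition push l w : seq letter :=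
  if w is l' :: w' then if l' == linv l then w' else l :: w else [:: l].

Definition reduced w : bool := sorted (fun l l' => l' != linv l) w.

Lemma push_reduced l w : reduced w -> reduced (push l w).
Proof.
case: w => [|l' w]//= wP; case: eqVneq => [_|ll']; last by rewrite /reduced/= ll'.
exact: path_sorted wP.
Qed.

Lemma pushK l w : reduced w -> push (linv l) (push l w) = w.
Proof.
case: w => [|l' w] /=; first by rewrite linvK eqxx.
case: (eqVneq l' (linv l)) => [->|ll'] /=; last by rewrite linvK eqxx.
by case: w => [|l2 w]//= /andP[/negPf -> _].
Qed.

Lemma push_nil w : reduced w -> foldr push [::] w = w.
Proof.
elim: w => [|l w IH]//= lw; rewrite IH; last exact: path_sorted lw.
by case: w lw {IH} => [|l' w]//= /andP[/negPf -> _].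
Qed.

Lemma foldr_push_reduced w z : reduced w -> reduced (foldr push w z).
Proof. by move=> wP; elim: z => //= l z; exact: push_reduced. Qed.

Lemma size_push l w : (size (push l w) <= (size w).+1)%N.
Proof. by case: w => [|l' w]//=; case: ifP => //= _; rewrite ltnW. Qed.

(* Multiplying [w] on the left by a reduced word either leaves the first letter
   of that word uncancelled, or cancels the word completely. *)
Lemma ohead_foldr_push w l z : reduced (l :: z) ->
  ohead (foldr push w (l :: z)) = Some l \/
  (size (foldr push w (l :: z)) + size (l :: z) = size w)%N.
Proof.
elim: z l => [|l2 z IH] l.
  by case: w => [|l' w] /=; [left|case: ifP => _ /=; [right; rewrite addn1|left]].
move=> /= /andP[l2l zP]; have /= := IH l2 zP.
case: (foldr push w z) => [|a u]; set v := push l2 _; case: v => [|l3 v] /=.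
- by case=> // <-; left.
- case: ifP => [/eqP ->|_]; last by left.
  case=> [[] e|<-]; last by right; rewrite addnS addSn.
  by rewrite e eqxx in l2l.
- by case=> // <-; left.
- case: ifP => [/eqP ->|_]; last by left.
  case=> [[] e|<-]; last by right; rewrite addnS addSn.
  by rewrite e eqxx in l2l.
Qed.

Section Evaluation.
Context (G : groupType) (y : letter -> G).
Hypothesis yV : forall l, y (linv l) = (y l)^-1%g.
Local Open Scope group_scope.

Definition ev w : G := foldr (fun l g => y l * g) 1 w.

Lemma ev_push l w : ev (push l w) = y l * ev w.
Proof.
by case: w => [|l' w] //=; case: eqP => [->|]//=; rewrite yV mulVKg.
Qed.

Lemma ev_foldr_push w z : ev (foldr push w z) = ev z * ev w.
Proof.
by elim: z => [|l z IH] /=; rewrite ?mul1g// ev_push IH mulgA.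
Qed.

Lemma ev_inv w : exists2 z, reduced z & ev z = (ev w)^-1.
Proof.
elim: w => [|l w [z zP zE]]; first by exists [::] => //; rewrite /= invg1.
exists (foldr push (push (linv l) [::]) z).
  by apply: foldr_push_reduced; apply: push_reduced.
by rewrite ev_foldr_push ev_push zE /= mulg1 yV -invgM.
Qed.

Definition orbit (s : G) : set G :=
  [set t | exists2 z, reduced z & t = ev z * s].

Lemma orbit_refl s : orbit s s.
Proof. by exists [::] => //; rewrite mul1g. Qed.

Lemma orbit_mul l s : orbit (y l * s) = orbit s.
Proof.
apply/seteqP; split=> t [z zP ->].
  exists (foldr push (push l [::]) z).
    by apply: foldr_push_reduced; apply: push_reduced.
  by rewrite ev_foldr_push ev_push /= mulg1 mulgA.
exists (foldr push (push (linv l) [::]) z).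
  by apply: foldr_push_reduced; apply: push_reduced.
by rewrite ev_foldr_push ev_push /= mulg1 yV mulgA mulgVK.
Qed.

Hypothesis ev_inj : {in reduced &, injective ev}.

(* Each left orbit of the free subgroup becomes a rooted tree: [height_word s]
   is the reduced word leading from the root of the orbit of [s] to [s]. *)
Definition root (s : G) : G := xget 1 (orbit s).

Definition height_word (s : G) : seq letter :=
  xget [::] [set z | reduced z /\ s = ev z * root s].

Lemma height_wordP s : reduced (height_word s) /\ s = ev (height_word s) * root s.
Proof.
rewrite /height_word; case: xgetP => [z _ //|none].
have [z zP rE] : orbit s (root s) by rewrite /root; apply: xgetPex; exists s; exact: orbit_refl.
have [z' z'P z'E] := ev_inv z.
by case: (none z'); split=> //; rewrite rE z'E mulKg.
Qed.

(** The root is chosen from the set [orbit s], which is the same set for [s] and [y l * s]; freeness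
    then leaves a single reduced word from that common root. *)
Lemma height_word_mul l s : height_word (y l * s) = push l (height_word s).
Proof.
have [r1 e1] := height_wordP s; have [r2 e2] := height_wordP (y l * s).
apply: ev_inj => //; first exact: push_reduced.
apply: (@mulIg _ (root s)); rewrite ev_push -mulgA -e1.
by rewrite [in RHS]e2 /root orbit_mul.
Qed.

End Evaluation.
End Words.
Arguments push {n} l w.

(** * Groups of bijections, and an action that makes the letters free *)

Section Bijections.
Local Open Scope group_scope.
Context {X : Type}.

Record bijection := Bijection {
  bij_fun :> X -> X; bij_inv : X -> X;
  bij_funK : cancel bij_fun bij_inv; bij_invK : cancel bij_inv bij_fun }.
Implicit Types a b c : bijection.

Lemma bijection_eq a b : bij_fun a = bij_fun b -> a = b.
Proof.
case: a b => [f f' fK f'K] [g g' gK g'K] /= e; case: _ / e in gK g'K *.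
have e : f' = g' by apply/funext => x; rewrite -{1}(g'K x) fK.
by case: _ / e in gK g'K *; congr Bijection; exact: Prop_irrelevance.
Qed.

HB.instance Definition _ := gen_eqMixin bijection.
HB.instance Definition _ := gen_choiceMixin bijection.

Definition bij_one : bijection := @Bijection id id (fun=> erefl) (fun=> erefl).
Definition bij_mul a b : bijection :=
  Bijection (can_comp (bij_funK a) (bij_funK b)) (can_comp (bij_invK b) (bij_invK a)).
Definition bij_opp a : bijection := Bijection (bij_invK a) (bij_funK a).

Lemma bij_mulA : associative bij_mul. Proof. by move=> a b c; exact: bijection_eq. Qed.
Lemma bij_mul1 : left_id bij_one bij_mul. Proof. by move=> a; exact: bijection_eq. Qed.
Lemma bij_1mul : right_id bij_one bij_mul. Proof. by move=> a; exact: bijection_eq. Qed.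
Lemma bij_mulV : left_inverse bij_one bij_opp bij_mul.
Proof. by move=> a; apply: bijection_eq; apply/funext => x /=; exact: bij_funK. Qed.
Lemma bij_Vmul : right_inverse bij_one bij_opp bij_mul.
Proof. by move=> a; apply: bijection_eq; apply/funext => x /=; exact: bij_invK. Qed.

HB.instance Definition _ :=
  isGroup.Build bijection bij_mulA bij_mul1 bij_1mul bij_mulV bij_Vmul.

Lemma bijM a b x : (a * b) x = a (b x). Proof. by []. Qed.

Lemma bijVK a x : a^-1 (a x) = x. Proof. exact: bij_funK. Qed.

End Bijections.
Arguments bijection : clear implicits.

Section FreeLetters.
Local Open Scope group_scope.

(** Over at most one letter, conjugation by that letter fixes every generator, so it is the identity
    by the uniqueness clause. Generators are then central, conjugation by any [y] fixes them too,
    and it is the identity by the same clause. *)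
Lemma free_two_letters (S : Type) (F : groupType) (iota : S -> F) :
  is_free_group iota -> (exists x y : F, ~ commute x y) -> exists a b : S, a <> b.
Proof.
move=> free [x [y xy]]; apply: contrapT => no_two; apply: xy.
have one_letter (s t : S) : s = t.
  by apply: contrapT => st; apply: no_two; exists s, t.
have [phi _ uniq] := free F iota.
pose cj (g : F) : {multiplicative F -> F} :=
  Multiplicative.Pack (Multiplicative.Class
    (isMultiplicative.Build F F (conjg^~ g) (fun x y => conjMg x y g))).
have cj_id g : (forall s, iota s ^ g = iota s) -> forall z, z ^ g = z.
  move=> fix_g z; rewrite -[LHS]/(cj g z) (uniq (cj g))//.
  by rewrite -(uniq (idfun : {multiplicative F -> F})).
have iota_y s : iota s ^ y = iota s.
  have : y ^ iota s = y by apply: cj_id => t; rewrite (one_letter t s) conjgE mulKg.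
  by move=> e; apply: (@mulgI _ y); rewrite -conjgC (conjgC y) e.
have : x ^ y = x by exact: cj_id.
by move=> e; rewrite /commute conjgC e.
Qed.

Section Action.
Context (n : nat).
Let X : Type := (seq (letter n) * 'I_n.+2)%type.

(** Leaving unreduced words fixed makes this a bijection of all sequences, with inverse
    [act (linv l)]. *)
Definition act (l : letter n) (w : seq (letter n)) : seq (letter n) :=
  if reduced w then push l w else w.

Lemma actK l : cancel (act l) (act (linv l)).
Proof.
move=> w; rewrite {2}/act; case: ifP => wP; last by rewrite /act wP.
by rewrite /act push_reduced// pushK.
Qed.

Lemma actVK l : cancel (act (linv l)) (act l).
Proof. by move=> w; rewrite -{1}(linvK l) actK. Qed.

Definition shift : bijection X :=
  @Bijection _ (fun x : X => (x.1, (x.2 + 1)%R)) (fun x : X => (x.1, (x.2 - 1)%R))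
    ltac:(by case=> w k /=; rewrite addrK) ltac:(by case=> w k /=; rewrite subrK).

Definition act_level : bijection X :=
  @Bijection _ (fun x : X => (act (x.2, true) x.1, x.2))
    (fun x : X => (act (x.2, false) x.1, x.2))
    ltac:(by case=> w k /=; rewrite (actK (k, true)))
    ltac:(by case=> w k /=; rewrite (actVK (k, true))).

Lemma shiftX k (x : X) : (shift ^+ k) x = (x.1, (x.2 + k%:R)%R).
Proof.
elim: k => [|k IH]; first by rewrite expg0 addr0; case: x.
by rewrite expgS bijM IH /= -addrA natr1.
Qed.

(** The power of [shift] lifts level 0 to level [k], [act_level] applies the letter of that level,
    and the inverse power comes back. *)
Lemma shift_conj (k : 'I_n.+2) (w : seq (letter n)) :
  (act_level ^ (shift ^+ k)) (w, 0%R) = (act (k, true) w, 0%R).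
Proof.
have e : (shift ^+ k) (w, 0%R) = (w, k) by rewrite shiftX /= add0r natr_Zp.
have e' : (shift ^+ k) (act (k, true) w, 0%R) = (act (k, true) w, k).
  by rewrite shiftX /= add0r natr_Zp.
by rewrite conjgE !bijM e -[act_level _]e' bijVK.
Qed.

End Action.

(* The letters [a^-k b a^k] are free: the universal property provides an action
   in which [a] shifts levels and [b] acts on reduced words, at level [k], by
   the letter [k]. *)
Lemma free_letters (Gamma : groupType) n : contains_noncommutative_free_group Gamma ->
  exists y : letter n -> Gamma,
    (forall l, y (linv l) = (y l)^-1) /\ {in @reduced n &, injective (ev y)}.
Proof.
move=> [S [F [iota [phi [free ncomm phi_inj]]]]].
have [a [b ab]] := free_two_letters free ncomm.
pose X : Type := (seq (letter n) * 'I_n.+2)%type.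
have [Phi PhiE _] := free (bijection X) (fun s =>
  if pselect (s = a) then shift n else if pselect (s = b) then act_level n else 1).
have Phi_a : Phi (iota a) = shift n by rewrite PhiE; case: pselect.
have Phi_b : Phi (iota b) = act_level n.
  by rewrite PhiE; case: (pselect (b = a)) => [/esym//|_] /=; case: (pselect (b = b)).
have gmulV (G1 G2 : groupType) (f : {multiplicative G1 -> G2}) x : f x^-1 = (f x)^-1.
  have f1 : f 1 = 1 by apply: (@mulgI _ (f 1)); rewrite -gmulfM !mulg1.
  by apply/esym/mulg1_eq; rewrite -gmulfM mulgV.
have gmulX (G1 G2 : groupType) (f : {multiplicative G1 -> G2}) x k : f (x ^+ k) = f x ^+ k.
  have f1 : f 1 = 1 by apply: (@mulgI _ (f 1)); rewrite -gmulfM !mulg1.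
  by elim: k => [|k IH]; rewrite ?expg0// !expgS gmulfM IH.
pose y0 (l : letter n) : F :=
  let x := iota b ^ (iota a ^+ l.1) in if l.2 then x else x^-1.
have y0V l : y0 (linv l) = (y0 l)^-1 by case: l => k [] //=; rewrite /y0/= invgK.
have Phi_y (l : letter n) w : Phi (y0 l) (w, 0%R) = (act l w, 0%R).
  have Phi_t k : Phi (iota b ^ (iota a ^+ k)) = act_level n ^ (shift n ^+ k).
    by rewrite conjgE !gmulfM gmulV gmulX Phi_a Phi_b.
  case: l => k [] /=; rewrite /y0/= ?gmulV Phi_t ?shift_conj//.
  by rewrite -[w in LHS](actVK (k, true)) -shift_conj bijVK.
(* Acting on the empty word reads a reduced word back from its value; injectivity of [ev] comes from
   this. *)
have Phi_ev w : reduced w -> Phi (ev y0 w) ([::], 0%R) = (w, 0%R).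
  move=> wP; rewrite -[in RHS](push_nil wP); elim: w {wP} => [|l w IH] /=.
    have -> : Phi 1 = 1 by apply: (@mulgI _ (Phi 1)); rewrite -gmulfM !mulg1.
    by [].
  by rewrite gmulfM bijM IH Phi_y /act foldr_push_reduced.
exists (phi \o y0); split=> [l|w w' wP w'P /= e]; first by rewrite /= y0V gmulV.
have ev_phi z : ev (phi \o y0) z = phi (ev y0 z).
  elim: z => [|l z IH] /=; last by rewrite gmulfM IH.
  by apply/esym/(@mulgI _ (phi 1)); rewrite -gmulfM !mulg1.
have {}e : ev y0 w = ev y0 w' by apply: phi_inj; rewrite -!ev_phi.
by have := Phi_ev _ w'P; rewrite -e Phi_ev// => -[].
Qed.

End FreeLetters.

(** * The adjacency operator of the tree on l^p *)

Section PowerMean.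
Context {R : realType}.
Implicit Types (p x m : R).

(** Young's inequality for [x] and [m ^ (p - 1)], with exponents [p] and [p / (p - 1)].
    Geometrically, the graph of the [p]-th power lies above its tangent at [m]. *)
Lemma powR_tangent p x m : 1 < p -> 0 <= x -> 0 <= m ->
  p * x * m `^ (p - 1) <= x `^ p + (p - 1) * m `^ p.
Proof.
move=> p1 x0 m0; have p0 : 0 < p by exact: lt_trans p1.
have pB1 : 0 < p - 1 by rewrite subr_gt0.
have := @conjugate_powR R x (m `^ (p - 1)) p (p / (p - 1)) x0 (powR_ge0 _ _) p0 (divr_gt0 p0 pB1).
rewrite -powRrM [_ * (p / _)]mulrC divfK ?gt_eqF//.
have -> : p^-1 + (p / (p - 1))^-1 = 1 by field; rewrite !gt_eqF.
move=> /(_ erefl); rewrite -(ler_pM2l p0) mulrA => /le_trans; apply.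
by rewrite le_eqVlt; apply/orP; left; apply/eqP; field; rewrite !gt_eqF.
Qed.

Lemma powR_sum_le p (J : finType) (a : J -> R) : 1 < p -> (forall j, 0 <= a j) ->
  (\sum_j a j) `^ p <= #|J|%:R `^ (p - 1) * \sum_j a j `^ p.
Proof.
move=> p1 a0; have p0 : 0 < p by exact: lt_trans p1.
have [J0|J0] := posnP #|J|.
  rewrite big1; last by move=> j _; have := card0_eq J0 j.
  rewrite powR0 ?gt_eqF// mulr_ge0 ?powR_ge0// sumr_ge0// => j _; exact: powR_ge0.
set k : R := #|J|%:R; have k0 : 0 < k by rewrite ltr0n.
set S := \sum_j a j; have S0 : 0 <= S by rewrite sumr_ge0.
(* The tangent inequalities at the mean add up to Jensen's inequality. *)
pose m := S / k; have m0 : 0 <= m by rewrite divr_ge0// ltW.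
have Sm : S = m * k by rewrite divfK// gt_eqF.
have : \sum_j (p * a j * m `^ (p - 1)) <= \sum_j (a j `^ p + (p - 1) * m `^ p).
  by apply: ler_sum => j _; exact: powR_tangent.
rewrite -mulr_suml -mulr_sumr -/S big_split/= sumr_const -mulr_natr -/k Sm.
have -> : p * (m * k) * m `^ (p - 1) = p * k * m `^ p.
  by rewrite -(mulr_powRB1 m0 p0); ring.
rewrite powRM ?(ltW k0)// -(mulr_powRB1 (ltW k0) p0) mulrA mulrC => h.
by rewrite [leLHS]mulrC ler_wpM2l ?powR_ge0//; lra.
Qed.

Lemma powR_add_le p x m : 1 < p -> 0 <= x -> 0 <= m ->
  (x + m) `^ p <= 2 `^ (p - 1) * (x `^ p + m `^ p).
Proof.
move=> p1 x0 m0; have := @powR_sum_le p bool (fun b => if b then x else m) p1.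
by rewrite card_bool !big_bool/=; apply; case.
Qed.

End PowerMean.

Section TreeOperator.
Context {R : realType} {G : groupType} {n : nat} (y : letter n -> G).
Hypothesis yV : forall l, y (linv l) = (y l)^-1%g.
Hypothesis ev_inj : {in @reduced n &, injective (ev y)}.
Implicit Types (f : G -> R) (s t : G) (l : letter n).

Local Notation hw := (height_word y).

(* The neighbour [y l * s] of [s] is its parent. *)
Let up l s : bool := ohead (hw s) == Some (linv l).

Let up_inj l l' s : up l s -> up l' s -> l = l'.
Proof.
by move=> /eqP h; rewrite /up h => /eqP [e b]; apply: (can_inj (@linvK n)); rewrite /linv e b.
Qed.

Let ohead_child l s : ~~ up l s -> ohead (hw (y l * s)%g) = Some l.
Proof.
rewrite /up height_word_mul//; case: (hw s) => [|l' w]//=.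
by case: (eqVneq l' (linv l)) => //= ->; rewrite eqxx.
Qed.

(** The first letter of the height word of a child names the edge to its parent, so [(s, l)] can be
    read off from [y l * s] and no vertex is counted twice. *)
Let sums_child f A : sums_le f A ->
  sums_le (fun s => \sum_(l | ~~ up l s) f (y l * s)%g) A.
Proof.
move=> fA J uJ.
pose K := [seq x <- [seq (s, l) | s <- J, l <- index_enum (letter n)] | ~~ up x.2 x.1].
pose h (x : G * letter n) := (y x.2 * x.1)%g.
have hK : uniq (map h K).
  rewrite map_inj_in_uniq.
    by rewrite filter_uniq// allpairs_uniq ?index_enum_uniq// => -[? ?] [].
  move=> [s l] [s' l']; rewrite !mem_filter /= => /andP[ul _] /andP[ul' _]; rewrite /h/= => e.
  have := ohead_child ul'; rewrite -e ohead_child// => -[e']; rewrite e' in e *.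
  by congr (_, _); apply: mulgI e.
apply: le_trans (fA _ hK); rewrite big_map big_filter big_flatten/= big_map.
by apply: ler_sum => s _; rewrite big_map.
Qed.

(** The inner sum has at most one term, so its power is at most the sum of the powers over all
    letters; each letter contributes a translate of one and the same family. *)
Let sums_parent f A (p : R) : 0 < p -> (forall s, 0 <= f s) -> sums_le (fun s => f s `^ p) A ->
  sums_le (fun s => (\sum_(l | up l s) f (y l * s)%g) `^ p) (#|{: letter n}|%:R * A).
Proof.
move=> p0 f0 fA.
apply: (@le_sums_le _ _ _ (fun s => \sum_l f (y l * s)%g `^ p)).
  move=> s; have [l ul|none] := pickP (up^~ s); last first.
    rewrite big_pred0// powR0 ?gt_eqF// sumr_ge0// => l _; exact: powR_ge0.
  rewrite (big_pred1 l); last first.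
    by move=> l'; apply/idP/eqP => [/(up_inj ul)->|->].
  by rewrite (bigD1 l)//= lerDl sumr_ge0// => l' _; exact: powR_ge0.
have -> : #|{: letter n}|%:R * A = \sum_(l : letter n) A.
  by rewrite sumr_const mulr_natl.
apply: sums_le_sum => l; apply: sums_le_inj fA; exact: mulgI.
Qed.

(* Splitting the neighbours of [s] into its parent and its children bounds the
   adjacency operator on l^p by [d^(1/p) + d^(1-1/p)]. *)
Lemma adjacency_sums f A (p : R) : 2 <= p -> (forall s, 0 <= f s) ->
  sums_le (fun s => f s `^ p) A ->
  sums_le (fun s => (\sum_l f (y l * s)%g) `^ p) (2 `^ p * #|{: letter n}|%:R `^ (p - 1) * A).
Proof.
move=> p2 f0 fA.
have p1 : 1 < p by rewrite (lt_le_trans _ p2)// ltr1n.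
have p0 : 0 < p by exact: lt_trans p1.
set d : R := #|{: letter n}|%:R.
have d1 : 1 <= d by rewrite ler1n card_prod card_ord card_bool.
have A0 : 0 <= A by exact: sums_le_ge0 fA.
pose P s := \sum_(l | up l s) f (y l * s)%g.
pose C s := \sum_(l | ~~ up l s) f (y l * s)%g.
(* Convexity over at most [d] children costs [d ^ (p - 1)]; this is the main term. *)
have CA : sums_le (fun s => C s `^ p) (d `^ (p - 1) * A).
  apply: (@le_sums_le _ _ _ (fun s => d `^ (p - 1) * \sum_(l | ~~ up l s) f (y l * s)%g `^ p)).
    move=> s; rewrite /C big_mkcond; apply: le_trans (powR_sum_le p1 _) _.
      by move=> l; case: ifP.
    rewrite ler_wpM2l ?powR_ge0// [leRHS]big_mkcond/=.
    by apply: ler_sum => l _; case: ifP => // _; rewrite powR0 ?gt_eqF.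
  by apply: sums_leZ; [exact: powR_ge0|exact: (sums_child fA)].
have PA : sums_le (fun s => P s `^ p) (d * A) by exact: sums_parent.
apply: (@le_sums_le _ _ _ (fun s => 2 `^ (p - 1) * (P s `^ p + C s `^ p))).
  move=> s; rewrite (bigID (up^~ s))/= powR_add_le//; exact: sumr_ge0.
apply: (@le_sums _ _ _ (2 `^ (p - 1) * (d * A + d `^ (p - 1) * A))); last first.
  by apply: sums_leZ; [exact: powR_ge0|exact: sums_leD].
have -> : 2 `^ p = 2 * 2 `^ (p - 1) :> R by rewrite mulr_powRB1.
(* Here [2 <= p] enters: the parent term is absorbed by the child term, and the doubling turns
   [2 ^ (p - 1)] into [2 ^ p]. *)
have dd : d <= d `^ (p - 1).
  by rewrite -{1}(powRr1 (le_trans ler01 d1)) ler_powR//; lra.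
rewrite -!mulrA mulrCA ler_wpM2l ?powR_ge0//.
by rewrite mulrDl mul1r lerD2r ler_wpM2r.
Qed.

End TreeOperator.

(** * The Hilbert space l^2(I) *)

Section Ell2.
Context {R : realType} {I : choiceType}.
Implicit Types (s : seq I) (z : R[i]).

Definition sqc z : R := complex.Re z ^+ 2 + complex.Im z ^+ 2.

Lemma sqc_ge0 z : 0 <= sqc z.
Proof. by rewrite addr_ge0 ?sqr_ge0. Qed.

Lemma sqcM a z : sqc (a * z) = sqc a * sqc z.
Proof. by case: a z => [a b] [u v]; rewrite /sqc/=; ring. Qed.

(** With [t = 1] this gives stability of square-summability under sums; with the optimal [t] it
    gives the triangle inequality. *)
Lemma sqcD_le (t : R) a b : 0 < t -> sqc (a + b) <= (1 + t) * sqc a + (1 + t^-1) * sqc b.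
Proof.
move=> t0; rewrite /sqc; case: a b => [a b] [u v]/=.
rewrite -subr_ge0.
have -> : (1 + t) * (a ^+ 2 + b ^+ 2) + (1 + t^-1) * (u ^+ 2 + v ^+ 2) -
  ((a + u) ^+ 2 + (b + v) ^+ 2) = t^-1 * ((t * a - u) ^+ 2 + (t * b - v) ^+ 2).
  by field; rewrite gt_eqF.
by rewrite mulr_ge0 ?invr_ge0 ?(ltW t0)// addr_ge0 ?sqr_ge0.
Qed.

Lemma sqc_eq0 z : sqc z <= 0 -> z = 0.
Proof.
case: z => a b; rewrite /sqc/= => h.
have a0 : a ^+ 2 = 0 by apply/eqP; rewrite eq_le sqr_ge0 andbT; nra.
have b0 : b ^+ 2 = 0 by apply/eqP; rewrite eq_le sqr_ge0 andbT; nra.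
by move/eqP: a0; move/eqP: b0; rewrite !sqrf_eq0 => /eqP -> /eqP ->.
Qed.

Definition sqsum : {pred I -> R[i]} :=
  fun f => `[< exists M, sums_le (fun i => sqc (f i)) M >].

Lemma sqsum_submod : submod_closed sqsum.
Proof.
split=> [|a f g].
  apply/asboolP; exists 0 => s _; rewrite big1// => i _.
  by rewrite /sqc/= expr0n addr0.
move=> /asboolP[M fM] /asboolP[M' gM]; apply/asboolP.
exists ((1 + 1) * (sqc a * M) + (1 + 1^-1) * M').
apply: (@le_sums_le _ _ _ (fun i => (1 + 1) * (sqc a * sqc (f i)) + (1 + 1^-1) * sqc (g i))).
  by move=> i; rewrite -sqcM; exact: sqcD_le.
apply: sums_leD; first by do 2! apply: sums_leZ => //; exact: sqc_ge0.
by apply: sums_leZ => //; rewrite invr1.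
Qed.

HB.instance Definition _ := GRing.isSubmodClosed.Build R[i] (I -> R[i]) sqsum sqsum_submod.

Record ell2 := Ell2 { ell2_fun :> I -> R[i]; _ : ell2_fun \in sqsum }.

HB.instance Definition _ := [isSub for ell2_fun].
HB.instance Definition _ := [Choice of ell2 by <:].
HB.instance Definition _ := [SubChoice_isSubLmodule of ell2 by <:].

Implicit Types (f g h : ell2) (c : R[i]).

Definition nsq f : R := total (fun i => sqc (f i)).

Lemma ell2_sums f : sums_le (fun i => sqc (f i)) (nsq f).
Proof. by case: f => f /[dup] /asboolP[M fM] ?; exact: total_ub fM. Qed.

Lemma nsq_le f M : sums_le (fun i => sqc (f i)) M -> nsq f <= M.
Proof. exact: total_le. Qed.

Lemma nsq_ge0 f : 0 <= nsq f.
Proof. exact: sums_le_ge0 (ell2_sums f). Qed.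

Lemma sqc_le_nsq f i : sqc (f i) <= nsq f.
Proof. exact: (sums_le_term i (ell2_sums f)). Qed.

Lemma nsqZ_le c f : nsq (c *: f) <= sqc c * nsq f.
Proof.
apply: nsq_le => s us; have := sums_leZ (sqc_ge0 c) (ell2_sums f) us.
by under eq_bigr do rewrite -sqcM.
Qed.

Lemma nsqZ c f : nsq (c *: f) = sqc c * nsq f.
Proof.
apply/eqP; rewrite eq_le nsqZ_le/=.
have [->|c0] := eqVneq c 0; first by rewrite /sqc/= expr0n addr0 mul0r nsq_ge0.
have := nsqZ_le c^-1 (c *: f); rewrite scalerA mulVf// scale1r => /(ler_wpM2l (sqc_ge0 c)).
by rewrite mulrA -sqcM divff// /sqc/= expr0n addr0 expr1n mul1r.
Qed.

Lemma nsq_eq0 f : nsq f = 0 -> f = 0.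
Proof.
move=> f0; apply/val_inj/funext => i /=.
by apply: sqc_eq0; rewrite -f0 sqc_le_nsq.
Qed.

Lemma sqrt_nsqD f g : Num.sqrt (nsq (f + g)) <= Num.sqrt (nsq f) + Num.sqrt (nsq g).
Proof.
have [f0|fN0] := eqVneq (nsq f) 0; first by rewrite (nsq_eq0 f0) add0r lerDr sqrtr_ge0.
have [g0|gN0] := eqVneq (nsq g) 0; first by rewrite (nsq_eq0 g0) addr0 lerDl sqrtr_ge0.
set a := Num.sqrt (nsq f); set b := Num.sqrt (nsq g).
have a0 : 0 < a by rewrite sqrtr_gt0 lt_def fN0 nsq_ge0.
have b0 : 0 < b by rewrite sqrtr_gt0 lt_def gN0 nsq_ge0.
rewrite -(@ler_pXn2r _ 2) ?nnegrE ?addr_ge0 ?sqrtr_ge0// sqr_sqrtr ?nsq_ge0//.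
(* For [t = b / a] the weighted bound is exactly [(a + b) ^ 2]. *)
have t0 : 0 < b / a by rewrite divr_gt0.
have -> : (a + b) ^+ 2 = (1 + b / a) * nsq f + (1 + (b / a)^-1) * nsq g.
  rewrite -[nsq f]sqr_sqrtr ?nsq_ge0// -[nsq g]sqr_sqrtr ?nsq_ge0// -/a -/b.
  by field; rewrite !gt_eqF.
apply: nsq_le.
apply: (@le_sums_le _ _ _ (fun i => (1 + b / a) * sqc (f i) + (1 + (b / a)^-1) * sqc (g i))).
  by move=> i; exact: sqcD_le.
by apply: sums_leD; apply: sums_leZ (ell2_sums _); rewrite addr_ge0// ?invr_ge0 ltW.
Qed.

Definition ell2_norm f : R[i] := (Num.sqrt (nsq f))%:C%C.

Lemma ell2_normD f g : ell2_norm (f + g) <= ell2_norm f + ell2_norm g.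
Proof. by rewrite -rmorphD/= lecR sqrt_nsqD. Qed.

Lemma ell2_normZ c f : ell2_norm (c *: f) = `|c| * ell2_norm f.
Proof. by rewrite /ell2_norm nsqZ sqrtrM ?sqc_ge0// rmorphM/= normc_def. Qed.

Lemma ell2_norm0_eq0 f : ell2_norm f = 0 -> f = 0.
Proof.
move=> /complexI/eqP; rewrite sqrtr_eq0 => f0.
by apply: nsq_eq0; apply/eqP; rewrite eq_le f0 nsq_ge0.
Qed.

HB.instance Definition _ :=
  Lmodule_isNormed.Build R[i] ell2 ell2_normD ell2_normZ ell2_norm0_eq0.

Lemma ell2_normE f : `|f| = (Num.sqrt (nsq f))%:C%C.
Proof. by []. Qed.

Lemma cvg_sqc (T : Type) (F : set_system T) (FF : Filter F) (s : seq I)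
    (u : T -> I -> R[i]) (v : I -> R[i]) :
  (forall i, complex.Re (u t i) @[t --> F] --> complex.Re (v i)) ->
  (forall i, complex.Im (u t i) @[t --> F] --> complex.Im (v i)) ->
  \sum_(i <- s) sqc (u t i) @[t --> F] --> \sum_(i <- s) sqc (v i).
Proof.
move=> uRe uIm; elim: s => [|i s IH].
  by rewrite big_nil; under eq_fun do rewrite big_nil; exact: cvg_cst.
rewrite big_cons; under eq_fun do rewrite big_cons.
by apply: cvgD => //; apply: cvgD; rewrite expr2; under eq_fun do rewrite expr2; exact: cvgM.
Qed.

Lemma ell2_ballP f g (e : R) : 0 < e -> ball f e%:C%C g <-> nsq (f - g) < e ^+ 2.
Proof.
move=> e0; rewrite -ball_normE/= ell2_normE ltcR.
rewrite -(@ltr_pXn2r _ 2) ?nnegrE ?sqrtr_ge0 ?(ltW e0)//.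
by rewrite sqr_sqrtr ?nsq_ge0.
Qed.

Lemma sqr_re_le z : complex.Re z ^+ 2 <= sqc z.
Proof. by rewrite lerDl sqr_ge0. Qed.

Lemma sqr_im_le z : complex.Im z ^+ 2 <= sqc z.
Proof. by rewrite lerDr sqr_ge0. Qed.

Lemma ell2_complete (F : set_system ell2) : ProperFilter F -> cauchy F -> cvg F.
Proof.
move=> FF /cauchyP Fc.
have {}Fc (e : R) : 0 < e -> exists g, \forall f \near F, nsq (g - f) < e ^+ 2.
  move=> e0; have e0' : 0 < e%:C%C by rewrite (ltcR 0).
  have [g gF] := Fc _ e0'; exists g.
  by apply: filterS gF => f /ell2_ballP; apply.
have coord (p : ell2 -> R) : (forall f g, (p f - p g) ^+ 2 <= nsq (f - g)) ->
    cvg (p @ F).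
  move=> pP; apply/cauchy_cvgP; apply: cauchy_exP => e e0.
  have [g gF] := Fc _ e0; exists (p g).
  apply: filterS gF => f gf; rewrite -ball_normE /= .
  rewrite -(@ltr_pXn2r _ 2) ?nnegrE ?(ltW e0)// real_normK ?num_real//.
  exact: le_lt_trans gf.
pose h i : R[i] := Complex (lim (complex.Re (f i) @[f --> F])) (lim (complex.Im (f i) @[f --> F])).
have hRe i : complex.Re (f i) @[f --> F] --> complex.Re (h i).
  apply: coord => f g; apply: le_trans (sqc_le_nsq _ i).
  by rewrite -raddfB; exact: sqr_re_le.
have hIm i : complex.Im (f i) @[f --> F] --> complex.Im (h i).
  apply: coord => f g; apply: le_trans (sqc_le_nsq _ i).
  by rewrite -raddfB; exact: sqr_im_le.
(* Only finite sums pass to a coordinatewise limit, but a bound on all of them bounds the l^2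
   distance. This serves twice: to place [h] in l^2 and to prove convergence to it. *)
have near_h g M : (\forall f \near F, nsq (g - f) < M) ->
    sums_le (fun i => sqc (g i - h i)) M.
  move=> gM s us.
  have C : \sum_(i <- s) sqc (g i - f i) @[f --> F] --> \sum_(i <- s) sqc (g i - h i).
    by apply: cvg_sqc => i; under eq_fun do rewrite raddfB/=; rewrite raddfB/=;
      apply: cvgB => //; exact: cvg_cst.
  rewrite -(cvg_lim _ C)//; apply: limr_le; first by apply/cvg_ex; eexists; exact: C.
  by apply: filterS gM => f /ltW; apply: le_trans; exact: (ell2_sums (g - f)).
have [g1 g1F] := Fc 1 ltr01.
have hP : h \in sqsum.
  have d1 : (fun i => g1 i - h i) \in sqsum.
    by apply/asboolP; exists (1 ^+ 2); exact: near_h.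
  have -> : h = (g1 : I -> R[i]) - (fun i => g1 i - h i).
    by apply/funext => i /=; rewrite !fctE opprB addrC subrK.
  by rewrite rpredB//; case: (g1).
apply/cvg_ex; exists (Ell2 hP); apply/cvgrPdist_lt => e e0.
have [e' e'0 ->] : exists2 e' : R, 0 < e' & e = e'%:C%C.
  exists (complex.Re e); first by move: e0; rewrite ltcE => /andP[].
  by rewrite RRe_real// gtr0_real.
have e20 : 0 < e' / 2 by rewrite divr_gt0.
have [g gF] := Fc _ e20.
apply: filterS (gF) => f gf.
rewrite -(subrKA g) (le_lt_trans (ler_normD _ _))//.
have -> : e'%:C%C = (e'/2)%:C%C + (e'/2)%:C%C by rewrite -rmorphD/= -splitr.
rewrite ler_ltD//; last by have /(ell2_ballP g f e20) := gf; rewrite -ball_normE.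
rewrite distrC ell2_normE lecR -(@ler_pXn2r _ 2) ?nnegrE ?sqrtr_ge0 ?(ltW e20)//.
rewrite sqr_sqrtr ?nsq_ge0//; apply: nsq_le; exact: near_h.
Qed.

HB.instance Definition _ := Uniform_isComplete.Build ell2 ell2_complete.

(** Polarization uses only sums of nonnegative terms, whose totals are already at hand. Linearity is
    recovered from [cvg_rip], which identifies the value with the usual sum. *)
Definition ell2_rip f g : R := (nsq (f + g) - nsq (f - g)) / 4.

Definition ell2_inner f g : R[i] := Complex (ell2_rip f g) (ell2_rip f ('i%C *: g)).

Lemma sqci : sqc 'i%C = 1.
Proof. by rewrite /sqc/= expr0n add0r expr1n. Qed.

Lemma nsqN f : nsq (- f) = nsq f.
Proof. by rewrite -scaleN1r nsqZ /sqc/= oppr0 expr0n addr0 sqrrN expr1n mul1r. Qed.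

Lemma ell2_ripC f g : ell2_rip f g = ell2_rip g f.
Proof. by rewrite /ell2_rip [f + g]addrC -[nsq (f - g)]nsqN opprB. Qed.

Lemma ell2_ripN f g : ell2_rip f (- g) = - ell2_rip f g.
Proof. by rewrite /ell2_rip opprK; ring. Qed.

Lemma ell2_rip_i f g : ell2_rip g ('i%C *: f) = - ell2_rip f ('i%C *: g).
Proof.
rewrite /ell2_rip.
have -> : g + 'i%C *: f = 'i%C *: (f - 'i%C *: g).
  by rewrite scalerBr scalerA -expr2 sqr_i scaleN1r opprK addrC.
have -> : g - 'i%C *: f = - ('i%C *: (f + 'i%C *: g)).
  by rewrite scalerDr scalerA -expr2 sqr_i scaleN1r opprD opprK addrC.
by rewrite nsqN !nsqZ sqci; ring.
Qed.

Lemma cvg_rip f g :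
  partial_sum (fun i => complex.Re (f i * (g i)^*%C)) @ totally --> ell2_rip f g.
Proof.
have C (u : ell2) : partial_sum (fun i => sqc (u i)) @ totally --> nsq u.
  by apply: cvg_total (ell2_sums u) => i; exact: sqc_ge0.
have -> : partial_sum (fun i => complex.Re (f i * (g i)^*%C)) =
    fun A => (partial_sum (fun i => sqc ((f + g) i)) A -
              partial_sum (fun i => sqc ((f - g) i)) A) / 4.
  apply/funext => A; rewrite /partial_sum -sumrB mulr_suml; apply: eq_bigr => i _ /=.
  rewrite !fctE /sqc; by case: (f _) (g _) => a b [u v] /=; field.
by apply: cvgM; [apply: cvgB; exact: C|exact: cvg_cst].
Qed.

Lemma cvg_iip f g :
  partial_sum (fun i => complex.Im (f i * (g i)^*%C)) @ totally --> ell2_rip f ('i%C *: g).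
Proof.
have := @cvg_rip f ('i%C *: g).
set a := partial_sum _; set b := partial_sum _; suff -> : a = b by [].
congr partial_sum; apply/funext => i; have -> : ('i%C *: g) i = 'i%C * g i by [].
by case: (f _) (g _) => x y [u v] /=; ring.
Qed.

Lemma ell2_rip_lin c f g h :
  ell2_rip (c *: f + g) h =
  complex.Re c * ell2_rip f h - complex.Im c * ell2_rip f ('i%C *: h) + ell2_rip g h.
Proof.
apply: cvg_unique (@cvg_rip (c *: f + g) h) _ => //.
pose L A := complex.Re c * partial_sum (fun i => complex.Re (f i * (h i)^*%C)) A
   - complex.Im c * partial_sum (fun i => complex.Im (f i * (h i)^*%C)) A
   + partial_sum (fun i => complex.Re (g i * (h i)^*%C)) A.
have -> : partial_sum (fun i => complex.Re ((c *: f + g) i * (h i)^*%C)) = L.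
  apply/funext => A; rewrite /L /partial_sum !mulr_sumr -sumrB -big_split/=.
  apply: eq_bigr => i _ /=.
  set j := fsval i; rewrite [LHS](_ : _ = complex.Re ((c * f j + g j) * (h j)^*%C))//.
  by clear L; case: (f _) (g _) (h _) c => a b [? ?] [? ?] [u v] /=; ring.
apply: cvgD; last exact: cvg_rip.
by apply: cvgB; (apply: cvgM; [exact: cvg_cst|]); [exact: cvg_rip|exact: cvg_iip].
Qed.

Lemma ell2_innerPl c f g h :
  ell2_inner (c *: f + g) h = c * ell2_inner f h + ell2_inner g h.
Proof.
rewrite /ell2_inner !ell2_rip_lin scalerA -['i%C * _]expr2 sqr_i scaleN1r ell2_ripN.
case: c => u v /=; apply/eqP; rewrite eq_complex/=; apply/andP; split; apply/eqP; ring.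
Qed.

Lemma ell2_innerC f g : ell2_inner f g = Num.conj (ell2_inner g f).
Proof.
by rewrite /ell2_inner ell2_ripC ell2_rip_i.
Qed.

Lemma ell2_innerff f : ell2_inner f f = `|f| ^+ 2.
Proof.
rewrite ell2_normE -rmorphXn/= sqr_sqrtr ?nsq_ge0//.
rewrite /ell2_inner /ell2_rip subrr.
have -> : f + f = 2%:R *: f by rewrite scaler_nat mulr2n.
have -> : f + 'i%C *: f = (1 + 'i%C) *: f by rewrite scalerDl scale1r.
have -> : f - 'i%C *: f = (1 - 'i%C) *: f by rewrite scalerBl scale1r.
have -> : nsq (0 : ell2) = 0 by rewrite -(scale0r f) nsqZ /sqc/= expr0n addr0 mul0r.
by rewrite !nsqZ /sqc/=; apply/eqP; rewrite eq_complex/=; apply/andP; split; apply/eqP; field.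
Qed.

Lemma ell2_inner_zmodl g : zmod_morphism (ell2_inner^~ g).
Proof.
move=> f h; rewrite -[f - h]addrC -scaleN1r ell2_innerPl mulN1r addrC//.
Qed.

Lemma ell2_inner_scalel g : scalable_for *%R (ell2_inner^~ g).
Proof.
move=> a f; rewrite -[a *: f]addr0 ell2_innerPl.
by rewrite -(subrr f) ell2_inner_zmodl subrr addr0.
Qed.

Lemma ell2_inner_zmodr f : zmod_morphism (ell2_inner f).
Proof. by move=> g h; rewrite !(ell2_innerC f) ell2_inner_zmodl rmorphB. Qed.

Lemma ell2_inner_scaler f : scalable_for (@Num.conj R[i] \; *%R) (ell2_inner f).
Proof. by move=> a g; rewrite !(ell2_innerC f) ell2_inner_scalel rmorphM. Qed.

HB.instance Definition _ := isBilinear.Build R[i] ell2 ell2 R[i] *%R (@Num.conj R[i] \; *%R)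
  ell2_inner ell2_inner_zmodl ell2_inner_zmodr ell2_inner_scalel ell2_inner_scaler.

Lemma ell2_inner_herm f g : ell2_inner f g = (-1) ^+ false * Num.conj (ell2_inner g f).
Proof. by rewrite expr0 mul1r ell2_innerC. Qed.

HB.instance Definition _ := isHermitianSesquilinear.Build R[i] ell2 false (@Num.conj R[i])
  ell2_inner ell2_inner_herm.

Lemma ell2_inner_gt0 f : f != 0 -> 0 < ell2_inner f f.
Proof. by move=> f0; rewrite ell2_innerff exprn_gt0// normr_gt0. Qed.

HB.instance Definition _ := isDotProduct.Build R[i] ell2 ell2_inner ell2_inner_gt0.

Definition ell2_hilbert : hilbert R := @Hilbert R ell2 ell2_inner ell2_innerff.

End Ell2.
Arguments ell2 R I : clear implicits.
Arguments ell2_hilbert R I : clear implicits.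

(** * Group algebra and representations *)

Section GroupAlgebra.
Context {R : realType} {G : groupType}.
Implicit Types (D E : seq (R * G)) (s : G).

(* Elements of the real group algebra are represented by formal sums. *)
Definition scale_sum (a : R) D : seq (R * G) := [seq (a * d.1, d.2) | d <- D].

Definition mul_sum D E : seq (R * G) :=
  [seq (d.1 * e.1, (d.2 * e.2)%g) | d <- D, e <- E].

Definition fn D s : R[i] := \sum_(d <- D) d.1%:C%C * (d.2 == s)%:R.

Lemma fn_cat D E s : fn (D ++ E) s = fn D s + fn E s.
Proof. by rewrite /fn big_cat. Qed.

Lemma fn_scale a D s : fn (scale_sum a D) s = a%:C%C * fn D s.
Proof.
rewrite /fn big_map mulr_sumr; apply: eq_bigr => d _ /=.
by rewrite rmorphM/= mulrA.
Qed.

Lemma sum_fn (V : normedModType R[i]) D (F : G -> V) :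
  sum (fun s => fn D s *: F s) = \sum_(d <- D) d.1%:C%C *: F d.2.
Proof.
rewrite /sum; apply: lim_near_cst => //.
exists [fset d.2 | d in D]%fset => // A DA; rewrite /= /partial_sum.
transitivity (\sum_(i : A) \sum_(d <- D) d.1%:C%C *: ((d.2 == val i)%:R *: F (val i))).
  by apply: eq_bigr => i _; rewrite scaler_suml; apply: eq_bigr => d _; rewrite scalerA.
rewrite exchange_big/= big_seq [RHS]big_seq; apply: eq_bigr => d dD.
have dA : d.2 \in A by apply: (fsubsetP DA); apply/imfsetP; exists d.
rewrite (bigD1 [` dA]%fset)//= eqxx scale1r big1 ?addr0// => i iN.
rewrite (_ : d.2 == val i = false) ?scale0r ?scaler0//.
by apply: contraNF iN => /eqP e; apply/eqP/val_inj.
Qed.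

Lemma lpP (p : R) (f : G -> R[i]) :
  lp G p f <-> exists A, sums_le (fun s => rnorm (f s : R[i]^o) `^ p) A.
Proof.
split=> [fp|[A fA]].
  have f0 : (0 <= \esum_(s in [set: G]) (rnorm (f s : R[i]^o) `^ p)%:E)%E.
    by apply: esum_ge0 => s _; rewrite lee_fin powR_ge0.
  exists (fine (\esum_(s in [set: G]) (rnorm (f s : R[i]^o) `^ p)%:E)) => J uJ.
  rewrite -lee_fin fineK ?ge0_fin_numE//; apply: esum_ge.
  exists [set` J]; first by split=> //; exact: finite_seq.
  by rewrite -fsbig_seq// sumEFin.
rewrite /lp/=; apply: (@le_lt_trans _ _ A%:E); last exact: ltry.
apply: ge_ereal_sup => _ [B [Bfin _] <-].
by rewrite fsbig_finite//= sumEFin lee_fin fA.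
Qed.

Lemma lp1_fn D : lp G 1 (fn D).
Proof.
apply/lpP; exists (\sum_(d <- D) `|d.1|).
apply: (@le_sums_le _ _ _ (fun s => \sum_(d <- D) `|d.1| * (d.2 == s)%:R)) => [s|J uJ].
  rewrite powRr1 ?rnorm_ge0// (le_trans (ler_rnorm_sum _ _))//.
  apply: ler_sum => d _; rewrite (@rnormZ _ R[i]^o).
  by rewrite ler_wpM2l// /rnorm normr_nat; case: (d.2 == s).
rewrite exchange_big; apply: ler_sum => d _; rewrite -mulr_sumr -[leRHS]mulr1.
rewrite ler_wpM2l// -natr_sum (ler_nat _ _ 1).
have -> : (\sum_(s <- J) (d.2 == s) = count_mem d.2 J)%N.
  by rewrite -sum1_count [RHS]big_mkcond; apply: eq_bigr => s _ /=; rewrite eq_sym; case: (s == _).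
by rewrite count_uniq_mem// leq_b1.
Qed.

Section Representation.
Context (H : hilbert R) (pi : unitary_rep G H).
Implicit Types x y : H.

Definition op D x : H := \sum_(d <- D) d.1%:C%C *: pi d.2 x.

Lemma op_cat D E x : op (D ++ E) x = op D x + op E x.
Proof. by rewrite /op big_cat. Qed.

Lemma op_scale a D x : op (scale_sum a D) x = a%:C%C *: op D x.
Proof.
rewrite /op big_map scaler_sumr; apply: eq_bigr => d _ /=.
by rewrite rmorphM/= scalerA.
Qed.

Lemma op_mul D E x : op (mul_sum D E) x = op D (op E x).
Proof.
rewrite /op big_flatten big_map; apply: eq_bigr => d _; rewrite big_map.
rewrite linear_sum/= scaler_sumr; apply: eq_bigr => e _.
by rewrite linearZ/= scalerA rmorphM urepM.
Qed.

Lemma opD D x y : op D (x + y) = op D x + op D y.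
Proof. by rewrite /op -big_split; apply: eq_bigr => d _; rewrite linearD scalerDr. Qed.

Lemma opN D x : op D (- x) = - op D x.
Proof. by rewrite /op -sumrN; apply: eq_bigr => d _; rewrite linearN scalerN. Qed.

Lemma op1 a x : op [:: (a, 1%g)] x = a%:C%C *: x.
Proof. by rewrite /op big_seq1 urep1. Qed.

Lemma integrated_fn D x : integrated pi (fn D) x = op D x.
Proof. exact: sum_fn. Qed.

Lemma pairing_l1_fn D x y : pairing_l1 (coef pi x y) (fn D) = inner H (op D x) y.
Proof.
rewrite /pairing_l1; transitivity (sum (fun s => fn D s *: (coef pi x y s : R[i]^o))).
  by congr sum; apply/funext => s; rewrite mulrC.
rewrite sum_fn /op linear_sumlz; apply: eq_bigr => d _.
by rewrite linearZl_LR.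
Qed.

Lemma rnorm_urep s x : rnorm (pi s x) = rnorm x.
Proof.
by apply/eqP; rewrite -(@eqrXn2 _ 2) ?rnorm_ge0// -!ipxx /ip urep_unitary.
Qed.

Lemma ip_urepV s x y : ip (pi s x) y = ip x (pi s^-1%g y).
Proof. by rewrite /ip -(urep_unitary pi s^-1%g) -urepM mulVg urep1. Qed.

Lemma opnorm_le D c : 0 <= c -> (forall x, rnorm (op D x) <= c * rnorm x) ->
  (opnorm (integrated pi (fn D)) <= c%:E)%E.
Proof.
move=> c0 Dc; apply: ge_ereal_sup => _ [x /= x1 <-].
rewrite integrated_fn lee_fin (le_trans (Dc x))//.
by rewrite -[leRHS]mulr1 ler_wpM2l.
Qed.

End Representation.
End GroupAlgebra.

(** * Square roots by iteration *)

Section SqrtIteration.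
Context {R : realType}.

(* The iteration [t -> (x + t^2) / 2] computes [1 - sqrt (1 - x)]; below, with
   [x = 1 - y^2], it computes [1 - |y|]. *)
Fixpoint qscal (k : nat) : R := if k is k'.+1 then (1 + qscal k' ^+ 2) / 2 else 0.

Lemma qscal_itv k : 0 <= qscal k <= 1.
Proof.
elim: k => [|k /andP[q0 q1]] /=; first by rewrite lexx ler01.
by apply/andP; split; nra.
Qed.

Lemma qscal_le k : qscal k <= qscal k.+1.
Proof. by have /andP[q0 q1] := qscal_itv k; rewrite /=; nra. Qed.

Lemma qscal_homo : {homo qscal : m k / (m <= k)%N >-> m <= k}.
Proof. by apply: homo_leq => //; [exact: le_trans|exact: qscal_le]. Qed.

Lemma qscal_cauchy (e : R) : 0 < e ->
  exists N, forall m k, (N <= m)%N -> (N <= k)%N -> `|qscal m - qscal k| < e.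
Proof.
move=> e0.
have qsup : has_sup (range qscal).
  split; first by exists (qscal 0), 0%N.
  by exists 1 => _ [k _ <-]; have /andP[] := qscal_itv k.
have [_ [N _ <-] qN] := sup_adherent e0 qsup.
exists N => m k /qscal_homo Nm /qscal_homo Nk.
have qm : qscal m <= sup (range qscal) by apply: sup_upper_bound => //; exists m.
have qk : qscal k <= sup (range qscal) by apply: sup_upper_bound => //; exists k.
by rewrite ltr_norml; apply/andP; split; lra.
Qed.

Context {H : hilbert R} (X Z : H -> H) (Q : nat -> H -> H).
Hypotheses (Q0 : forall x, Q 0 x = 0)
  (QS : forall k x, Q k.+1 x = (2^-1)%:C%C *: (X x + Q k (Q k x)))
  (QB : forall k x y, Q k (x - y) = Q k x - Q k y).

Section UnitBall.
Hypothesis X1 : forall x, rnorm (X x) <= rnorm x.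

(** [qscal] is the same iteration run on the scalar 1, and it dominates the iteration of any
    contraction; its values are independent of the representation. *)
Lemma sqrt_iter_bound k x : rnorm (Q k x) <= qscal k * rnorm x.
Proof.
elim: k x => [|k IH] x; first by rewrite Q0 rnorm0 mul0r.
have /andP[q0 q1] := qscal_itv k.
rewrite QS rnormZ ger0_norm ?invr_ge0//= mulrAC mulrC ler_wpM2r ?invr_ge0//.
rewrite (le_trans (ler_rnormD _ _))// mulrDl mul1r lerD//.
by rewrite (le_trans (IH _))// expr2 -mulrA ler_wpM2l.
Qed.

Lemma sqrt_iter_step k x : rnorm (Q k.+1 x - Q k x) <= (qscal k.+1 - qscal k) * rnorm x.
Proof.
elim: k x => [|k IH] x.
  rewrite QS !Q0 subr0 addr0 rnormZ ger0_norm ?invr_ge0//= expr0n addr0 subr0 mul1r.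
  by rewrite ler_wpM2l ?invr_ge0.
have /andP[q0 q1] := qscal_itv k; have /andP[p0 p1] := qscal_itv k.+1.
have pq := qscal_le k.
(* A difference of squares, split as [(B - A) B + A (B - A)]; the scalar increments are split in the
   same way. *)
have -> : Q k.+2 x - Q k.+1 x = (2^-1)%:C%C *:
    ((Q k.+1 (Q k.+1 x) - Q k (Q k.+1 x)) + Q k (Q k.+1 x - Q k x)).
  rewrite QB addrA subrK [Q k.+2 x]QS [X in _ - X = _]QS -scalerBr.
  by congr (_ *: _); rewrite opprD addrACA subrr add0r.
rewrite rnormZ ger0_norm ?invr_ge0//.
have -> : qscal k.+2 - qscal k.+1 =
  2^-1 * ((qscal k.+1 - qscal k) * qscal k.+1 + qscal k * (qscal k.+1 - qscal k)).
  transitivity ((1 + qscal k.+1 ^+ 2) / 2 - (1 + qscal k ^+ 2) / 2); first by [].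
  by field.
rewrite -mulrA ler_wpM2l ?invr_ge0// (le_trans (ler_rnormD _ _))// mulrDl lerD//.
  rewrite (le_trans (IH _))// -mulrA ler_wpM2l ?subr_ge0//; exact: sqrt_iter_bound.
by rewrite (le_trans (sqrt_iter_bound _ _))// -mulrA ler_wpM2l.
Qed.

Lemma sqrt_iter_dist m k x : (m <= k)%N ->
  rnorm (Q k x - Q m x) <= (qscal k - qscal m) * rnorm x.
Proof.
move=> /subnKC <-; elim: (k - m)%N => [|j IH]; first by rewrite addn0 !subrr rnorm0 mul0r.
rewrite addnS -(subrKA (Q (m + j) x)) (le_trans (ler_rnormD _ _))//.
rewrite -(subrKA (qscal (m + j)) (qscal (m + j).+1)) mulrDl lerD//; exact: sqrt_iter_step.
Qed.

End UnitBall.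

Section Contraction.
Context (a : R).
Hypotheses (a0 : 0 <= a) (a1 : a <= 1).
Hypotheses (Z1 : forall x, rnorm (Z x) <= a * rnorm x).
Hypothesis XZ : forall x, X x = 2%:C%C *: Z x - Z (Z x).
Hypothesis X1 : forall x, rnorm (X x) <= rnorm x.

(** [XZ] makes [Z] a fixed point of the iteration. Hence [2 (Z - Q k.+1) = (Z - Q k) Z + Q k (Z - Q
    k)], where [Z] has norm at most [a] and [Q k] at most 1; the ratio [(1 + a) / 2] follows. *)
Lemma sqrt_iter_cvg k x : rnorm (Z x - Q k x) <= ((1 + a) / 2) ^+ k * rnorm x.
Proof.
elim: k x => [|k IH] x.
  by rewrite Q0 subr0 mul1r (le_trans (Z1 _))// ler_piMl// rnorm_ge0.
have -> : Z x - Q k.+1 x = (2^-1)%:C%C *: ((Z (Z x) - Q k (Z x)) + Q k (Z x - Q k x)).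
  have half2 z : (2^-1)%:C%C *: (2%:C%C *: z) = z :> H.
    by rewrite scalerA -rmorphM/= mulVf// scale1r.
  rewrite QB addrA subrK QS XZ -{1}(half2 (Z x)) -scalerBr.
  by rewrite opprD opprB addrA [_ + (_ - _)]addrC subrK.
rewrite rnormZ ger0_norm ?invr_ge0//.
set b := (1 + a) / 2; have b0 : 0 <= b by rewrite divr_ge0// addr_ge0.
have h1 := IH (Z x); have h2 := Z1 x.
have h3 : rnorm (Q k (Z x - Q k x)) <= b ^+ k * rnorm x.
  rewrite (le_trans (sqrt_iter_bound X1 _ _))//.
  have /andP[q0 q1] := qscal_itv k.
  by rewrite (le_trans _ (IH x))// ler_piMl ?rnorm_ge0.
have bk0 : 0 <= b ^+ k by rewrite exprn_ge0.
rewrite exprS (le_trans (ler_wpM2l _ (ler_rnormD _ _)))//.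
have : b ^+ k * rnorm (Z x) <= b ^+ k * (a * rnorm x) by rewrite ler_wpM2l.
rewrite /b; move: (b ^+ k) bk0 h1 h3 => B; nra.
Qed.

End Contraction.
End SqrtIteration.

(** * The average of the free letters in an l^p-representation *)

Section TreeAverage.
Context {R : realType} {G : groupType} {n : nat} (y : letter n -> G).
Hypothesis yV : forall l, y (linv l) = (y l)^-1%g.

Local Notation d := (#|{: letter n}|%:R : R).

Lemma letter_gt0 : 0 < d.
Proof. by rewrite ltr0n card_prod card_ord card_bool. Qed.

Definition avg : seq (R * G) := [seq (d^-1, y l) | l <- index_enum (letter n)].

Context {H : hilbert R} (pi : unitary_rep G H).
Local Notation T := (op pi avg).

Lemma op_avg x : T x = (d^-1)%:C%C *: \sum_l pi (y l) x.
Proof. by rewrite /op big_map scaler_sumr. Qed.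

Lemma op_avg_sym x z : ip (T x) z = ip x (T z).
Proof.
rewrite !op_avg ipZl ipZr ip_suml ipC ip_suml; congr (_ * _).
rewrite (reindex_inj (can_inj (@linvK n))); apply: eq_bigr => l _.
by rewrite yV ip_urepV invgK ipC.
Qed.

Lemma op_avg_le x : rnorm (T x) <= rnorm x.
Proof.
rewrite op_avg rnormZ ger0_norm ?invr_ge0//.
rewrite ler_pdivrMl ?letter_gt0// (le_trans (ler_rnorm_sum _ _))//.
under eq_bigr do rewrite rnorm_urep.
by rewrite sumr_const mulr_natl.
Qed.

Section LpRep.
Context (p : R).
Hypotheses (p2 : 2 <= p) (pi_lp : is_lp_rep p pi).
Hypothesis ev_inj : {in @reduced n &, injective (ev y)}.

Let rho : R := 2 * d `^ (- p^-1).

(** A single moment obeys no recursion, but the functions sending [s] to [ip (T^k (pi s z)) z] do: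
    each is dominated by the tree average of the preceding one. Their l^p norms are thus bounded by
    a multiple of [rho ^ k], and their values at 1 are the moments that [sym_bound] asks for. *)
Lemma lp_rep_avg_le x : rnorm (T x) <= rho * rnorm x.
Proof.
have p0 : 0 < p by rewrite (lt_le_trans _ p2).
have pN0 : p != 0 by rewrite gt_eqF.
have d0 := letter_gt0.
have rho0 : 0 < rho by rewrite mulr_gt0// powR_gt0.
have rhop : rho `^ p = 2 `^ p * d^-1.
  by rewrite powRM ?powR_ge0// -powRrM mulNr mulVf// powR_inv1// ltW.
have [H0 [H00 H0lin H0dense H0lp]] := pi_lp.
have onH0 z : H0 z -> rnorm (T z) <= rho * rnorm z.
  move=> /H0lp/lpP[A phiA].
  pose F k s : R := `|ip (iter k T (pi s z)) z|.
  have F0 k s : 0 <= F k s by exact: normr_ge0.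
  have FA k : sums_le (fun s => F k s `^ p) ((rho `^ p) ^+ k * A).
    elim: k => [|k IH].
      rewrite mul1r; apply: le_sums_le phiA => s.
      apply: ge0_ler_powR; rewrite ?nnegrE ?rnorm_ge0 ?F0 ?(ltW p0)//.
      by rewrite /F /= /ip /coef -lecR rnormE; exact: normc_ge_Re.
    apply: (@le_sums_le _ _ _ (fun s => (d^-1) `^ p * (\sum_l F k (y l * s)%g) `^ p)).
      move=> s; rewrite -powRM ?invr_ge0 ?(ltW d0) ?sumr_ge0//.
      apply: ge0_ler_powR; rewrite ?nnegrE ?F0 ?mulr_ge0 ?invr_ge0 ?(ltW d0) ?sumr_ge0 ?(ltW p0)//.
      rewrite /F iterSr iter_sym; last exact: op_avg_sym.
      rewrite op_avg ipZl ip_suml normrM ger0_norm ?invr_ge0 ?(ltW d0)//.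
      rewrite ler_wpM2l ?invr_ge0 ?(ltW d0)// (le_trans (ler_norm_sum _ _ _))//.
      by apply: ler_sum => l _; rewrite urepM iter_sym//; exact: op_avg_sym.
    (* The average contributes [d ^ (- p)] and the adjacency bound [2 ^ p * d ^ (p - 1)]; the
       product is [rho ^ p]. *)
    have := @adjacency_sums R G n y yV ev_inj (F k) _ p p2 (F0 k) IH.
    move=> /(sums_leZ (powR_ge0 d^-1 p)); apply: le_sums.
    rewrite exprS {2}rhop -powR_inv1 ?(ltW d0)// -powRrM mulN1r.
    rewrite [leLHS](_ : _ =
      (d `^ (- p) * d `^ (p - 1)) * (2 `^ p * ((rho `^ p) ^+ k * A))); last by ring.
    rewrite -powRD ?(gt_eqF d0) ?implybT// addKr.
    by rewrite le_eqVlt; apply/orP; left; apply/eqP; ring.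
  have := @sym_bound _ _ T op_avg_sym rho (A `^ p^-1) z rho0; apply=> k.
  have A0 : 0 <= A by exact: sums_le_ge0 phiA.
  have := sums_le_term 1%g (FA k); rewrite /F urep1 => h.
  rewrite (le_trans (ler_norm _))// -[leLHS]powRr1// -(divff pN0) powRrM.
  apply: le_trans (ge0_ler_powR _ _ _ h) _; rewrite ?nnegrE ?powR_ge0 ?invr_ge0 ?(ltW p0)//.
    by rewrite mulr_ge0// exprn_ge0// powR_ge0.
  rewrite powRM ?exprn_ge0 ?powR_ge0// mulrC -powR_mulrn ?powR_ge0// -!powRrM.
  by rewrite mulrCA divff// mulr1 powR_mulrn// ltW.
apply/ler_addgt0Pr => e e0.
(* Replacing [x] by [z] costs at most [rnorm (x - z)] on the left, since [T] is a contraction, and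
   [rho] times as much on the right. *)
have e'0 : 0 < e / (rho + 1) by rewrite divr_gt0// addr_gt0.
have [] := H0dense (ball x (e / (rho + 1))%:C%C).
- by exists x; apply: ballxx; rewrite (ltcR 0).
- exact: ball_open.
move=> z []; rewrite -ball_normE/= -rnormE ltcR => xz /onH0 zle.
rewrite -(subrK z x) opD (le_trans (ler_rnormD _ _))//.
have h1 := op_avg_le (x - z).
have h2 := ler_rnormB (x - (x - z)) 0; have h3 := ler_rnormB x (x - z).
rewrite opprB addrC subrK in h3.
have : (rho + 1) * rnorm (x - z) <= e by rewrite mulrC -ler_pdivlMr ?addr_gt0// ltW.
have : rho * rnorm z <= rho * (rnorm x + rnorm (x - z)) by rewrite ler_wpM2l// ltW.
by rewrite subrK; nra.
Qed.

End LpRep.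
End TreeAverage.

(** * The separating element of the C*-algebra *)

Section Pairing.
Context {R : realType} {G : groupType}.

Lemma cvg_rnorm (V : normedModType R[i]) (u : nat -> V) w :
  (forall e : R, 0 < e -> \forall k \near \oo, rnorm (w - u k) < e) -> u @ \oo --> w.
Proof.
move=> uw; apply/cvgrPdist_lt => e e0.
have eE : (complex.Re e)%:C%C = e by rewrite RRe_real// gtr0_real.
have /uw : 0 < complex.Re e by rewrite -ltcR eE.
by apply: filterS => k; rewrite -ltcR eE rnormE.
Qed.

Lemma cauchy_rnorm (H : hilbert R) (u : nat -> H) :
  (forall e : R, 0 < e -> exists N, forall k, (N <= k)%N -> rnorm (u N - u k) < e) ->
  exists w, forall e : R, 0 < e -> \forall k \near \oo, rnorm (w - u k) < e.
Proof.
move=> uC; have : cvg (u @ \oo).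
  apply: cauchy_cvg; apply: cauchy_exP => e e0.
  have eE : (complex.Re e)%:C%C = e by rewrite RRe_real// gtr0_real.
  have /uC[N uN] : 0 < complex.Re e by rewrite -ltcR eE.
  exists (u N); exists N => // k /uN; rewrite /= -ball_normE/= -eE -rnormE ltcR.
  by [].
move=> /cvg_ex[w /cvgrPdist_lt uw]; exists w => e e0.
have /uw : 0 < e%:C%C by rewrite (ltcR 0).
by apply: filterS => k; rewrite -rnormE ltcR.
Qed.

Lemma cvg_inner (H : hilbert R) (u : nat -> H) w v :
  (forall e : R, 0 < e -> \forall k \near \oo, rnorm (w - u k) < e) ->
  (inner H (u k) v : R[i]^o) @[k --> \oo] --> (inner H w v : R[i]^o).
Proof.
move=> uw; apply: cvg_rnorm => e e0.
have v0 : 0 < rnorm v + 1 by rewrite ltr_wpDl ?rnorm_ge0.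
have /uw : 0 < e / 2 / (rnorm v + 1) by rewrite !divr_gt0.
apply: filterS => k; rewrite ltr_pdivlMr// => wu.
have -> : inner H w v - inner H (u k) v = inner H (w - u k) v by rewrite linearBl.
set z := inner H (w - u k) v.
have zle : rnorm (z : R[i]^o) <= `|complex.Re z| + `|complex.Im z|.
  rewrite {1}[z]complexE (le_trans (ler_rnormD _ _))// lerD//.
    by rewrite /rnorm normc_def/= expr0n addr0 sqrtr_sqr.
  rewrite [_ * _](_ : _ = (complex.Im z)%:C%C *: ('i%C : R[i]^o)); last exact: mulrC.
  by rewrite rnormZ /rnorm normc_def/= expr0n add0r expr1n sqrtr1 mulr1.
have h1 := ip_CauchySchwarz (w - u k) v; have h2 := inner_abs (w - u k) v.
have := rnorm_ge0 (w - u k); rewrite /ip -/z in h1; rewrite -/z in h2.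
move: wu zle; rewrite mulrDr mulr1; lra.
Qed.

(** Evaluation at [a] is a coordinate of the product topology, hence continuous on [weak_star], and
    its zero set is closed. *)
Lemma closure_pairing0 (A : set (G -> R[i])) (a : cstar G) u :
  (forall v, A v -> pairing v a = 0) -> closure (A : set (weak_star G)) u -> pairing u a = 0.
Proof.
move=> A0.
pose ev_a (v : weak_star G) : R[i]^o := pairing v a.
have ev_cont : continuous ev_a.
  move=> v; apply: (@continuous_comp _ _ _ (pairing : weak_star G -> {ptws cstar G -> R[i]^o})
    (fun f => f a)).
    exact: initial_continuous.
  pose f : {ptws cstar G -> R[i]^o} := pairing v.
  have f_f : nbhs f --> f by exact: cvg_id.
  have /(_ _) h := (cvg_sup _ _ _).1 f_f a.
  move=> U nU.
  have hU := @initial_continuous _ _ (fun f : (forall _ : cstar G, R[i]^o) => f a) (pairing v) U nU.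
  exact: h hU.
have cl : closed (ev_a @^-1` [set 0]).
  apply: closed_comp => [? _|]; [exact: ev_cont|].
  by apply: accessible_closed_set1; apply: hausdorff_accessible; exact: norm_hausdorff.
have Asub : (A : set (weak_star G)) `<=` ev_a @^-1` [set 0] by move=> v /A0.
by move=> /(closure_subset Asub); rewrite -(closure_id _).1.
Qed.

End Pairing.

Section SpectralElement.
Context {R : realType} {G : groupType} {n : nat} (y : letter n -> G) (c : R).
Hypothesis yV : forall l, y (linv l) = (y l)^-1%g.
Hypotheses (c0 : 0 <= c) (c1 : c <= 1).

(** The factor 1/2 makes Y a contraction, T and c being at most 1. With Z = 1 + Y one has 1 - Y^2 =
    2 Z - Z^2, so Z is a fixed point of the iteration [Qsum]. The limit of the iteration is 1 - |Y|,
    which agrees with Z exactly when Y is nonpositive. *)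
Let Ysum : seq (R * G) :=
  scale_sum 2^-1 (mul_sum (avg y) (avg y) ++ [:: (- c ^+ 2, 1%g)]).
Let Zsum : seq (R * G) := (1, 1%g) :: Ysum.
Let Xsum : seq (R * G) := (1, 1%g) :: scale_sum (-1) (mul_sum Ysum Ysum).
Fixpoint Qsum (k : nat) : seq (R * G) :=
  if k is k'.+1 then scale_sum 2^-1 (Xsum ++ mul_sum (Qsum k') (Qsum k')) else [::].

(* The limit of these elements is [Y + |Y|], where [Y = (T^2 - c^2) / 2] and
   [T] is the average of the letters. *)
Let Asum k : seq (R * G) := Zsum ++ scale_sum (-1) (Qsum k).

Section Operators.
Context (H : hilbert R) (pi : unitary_rep G H).
Local Notation T := (op pi (avg y)).
Implicit Types x v : H.

Let op_cons1 D x : op pi ((1, 1%g) :: D) x = x + op pi D x.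
Proof. by rewrite -cat1s op_cat op1 scale1r. Qed.

Let op_opp D x : op pi (scale_sum (-1) D) x = - op pi D x.
Proof. by rewrite op_scale rmorphN scaleN1r. Qed.

Let op_Ysum x : op pi Ysum x = (2^-1)%:C%C *: (T (T x) - (c ^+ 2)%:C%C *: x).
Proof. by rewrite op_scale op_cat op_mul op1 rmorphN scaleNr. Qed.

Let op_Ysum_le x : rnorm (op pi Ysum x) <= rnorm x.
Proof.
rewrite op_Ysum rnormZ ger0_norm ?invr_ge0//.
have h1 := ler_rnormB (T (T x)) ((c ^+ 2)%:C%C *: x).
have h2 := le_trans (op_avg_le y pi (T x)) (op_avg_le y pi x).
rewrite rnormZ ger0_norm ?sqr_ge0// in h1.
have : c ^+ 2 * rnorm x <= rnorm x by rewrite ler_piMl ?rnorm_ge0// expr_le1.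
lra.
Qed.

Let op_Ysum_sym x v : ip (op pi Ysum x) v = ip x (op pi Ysum v).
Proof.
rewrite !op_Ysum ipZl ipZr !ipDl !ipDr !ipNl !ipNr ipZl ipZr.
by rewrite !op_avg_sym.
Qed.

Let op_Xsum x : op pi Xsum x = x - op pi Ysum (op pi Ysum x).
Proof. by rewrite op_cons1 op_opp op_mul. Qed.

(** Symmetry of Y gives [|x - Y^2 x|^2 = |x|^2 - 2 |Y x|^2 + |Y^2 x|^2], and the last term is at
    most [|Y x|^2]. *)
Let op_Xsum_le x : rnorm (op pi Xsum x) <= rnorm x.
Proof.
rewrite op_Xsum; set u := op pi Ysum x.
rewrite -(@ler_pXn2r _ 2) ?nnegrE ?rnorm_ge0// sqr_rnormB -op_Ysum_sym -/u ipxx.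
have := op_Ysum_le u; have := rnorm_ge0 (op pi Ysum u).
by have := rnorm_ge0 u; nra.
Qed.

Let op_XZ x : op pi Xsum x = 2%:C%C *: op pi Zsum x - op pi Zsum (op pi Zsum x).
Proof.
rewrite op_Xsum !op_cons1 opD.
set u := op pi Ysum x; set w := op pi Ysum u.
have -> : 2%:C%C *: (x + u) = (x + u) + (x + u).
  by rewrite -[2]/(1 + 1) rmorphD rmorph1 scalerDl scale1r.
by rewrite addrKA opprD addrA addrK.
Qed.

Let op_Qsum0 x : op pi (Qsum 0) x = 0.
Proof. by rewrite /op big_nil. Qed.

Let op_QsumS k x : op pi (Qsum k.+1) x =
  (2^-1)%:C%C *: (op pi Xsum x + op pi (Qsum k) (op pi (Qsum k) x)).
Proof. by rewrite op_scale op_cat op_mul. Qed.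

Let op_QsumB k x v : op pi (Qsum k) (x - v) = op pi (Qsum k) x - op pi (Qsum k) v.
Proof. by rewrite opD opN. Qed.

Let op_Asum k x : op pi (Asum k) x = op pi Zsum x - op pi (Qsum k) x.
Proof. by rewrite op_cat op_opp. Qed.

Lemma op_Qsum_dist k m x :
  rnorm (op pi (Qsum k) x - op pi (Qsum m) x) <= `|qscal k - qscal m| * rnorm x.
Proof.
have dist i j : (i <= j)%N ->
    rnorm (op pi (Qsum j) x - op pi (Qsum i) x) <= `|qscal j - qscal i| * rnorm x.
  move=> ij; rewrite (le_trans (sqrt_iter_dist op_Qsum0 op_QsumS op_QsumB op_Xsum_le x ij))//.
  by rewrite ler_wpM2r ?rnorm_ge0// ler_norm.
case: (leqP m k) => [/dist//|/ltnW/dist].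
by rewrite -rnormN opprB distrC.
Qed.

Lemma op_Asum_cvg0 (rho : R) x : 0 <= rho -> rho < c ->
  (forall x, rnorm (T x) <= rho * rnorm x) ->
  forall e, 0 < e -> \forall k \near \oo, rnorm (0 - op pi (Asum k) x) < e.
Proof.
move=> rho0 rhoc Trho e e0.
(* Z is [(1 - c^2 / 2) + T^2 / 2], so [a] bounds its norm; [rho < c] is what makes [a < 1]. *)
pose a : R := 1 - c ^+ 2 / 2 + rho ^+ 2 / 2.
have c2 : c ^+ 2 <= 1 by rewrite expr_le1.
have pos : 0 <= 1 - c ^+ 2 / 2 by lra.
have Z1 v : rnorm (op pi Zsum v) <= a * rnorm v.
  have -> : op pi Zsum v = (1 - c ^+ 2 / 2)%:C%C *: v + (2^-1)%:C%C *: T (T v).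
    rewrite op_cons1 op_Ysum scalerBr scalerA addrCA addrC -rmorphM/=.
    by rewrite rmorphB rmorph1 scalerBl scale1r (mulrC 2^-1).
  rewrite (le_trans (ler_rnormD _ _))// !rnormZ (ger0_norm pos) ger0_norm ?invr_ge0//.
  have := le_trans (Trho (T v)) (ler_wpM2l rho0 (Trho v)).
  rewrite /a; lra.
have a0 : 0 <= a by rewrite /a; nra.
have a1 : a < 1 by rewrite /a; nra.
clearbody a.
have b1 : `|(1 + a) / 2| < 1.
  by rewrite ger0_norm ?divr_ge0 ?addr_ge0// ltr_pdivrMr// mul1r -[2]/(1 + 1) ltrD2l.
have x1 : 0 < rnorm x + 1 by rewrite ltr_wpDl ?rnorm_ge0.
have /cvgrPdist_lt /(_ (e / (rnorm x + 1)))[|N _ bN] := cvg_expr b1; first by rewrite divr_gt0.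
exists N => // k /bN; rewrite /= !sub0r normrN rnormN op_Asum ltr_pdivlMr// => bk.
apply: le_lt_trans (sqrt_iter_cvg op_Qsum0 op_QsumS op_QsumB a0 (ltW a1) Z1 op_XZ op_Xsum_le k x) _.
apply: le_lt_trans bk; rewrite (le_trans (ler_wpM2r _ (ler_norm _))) ?rnorm_ge0//.
by rewrite ler_wpM2l// lerDl.
Qed.

(** [Asum k] is Y + (1 - [Qsum k]), and the second summand has a nonnegative quadratic form because
    [Qsum k] acts as a contraction. What remains is the quadratic form of Y. *)
Lemma ip_Asum_ge k v : (rnorm (T v) ^+ 2 - c ^+ 2 * rnorm v ^+ 2) / 2 <= ip (op pi (Asum k) v) v.
Proof.
rewrite op_Asum op_cons1 ipDl ipNl ipDl op_Ysum ipZl ipDl ipNl ipZl op_avg_sym// !ipxx.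
have := ip_CauchySchwarz (op pi (Qsum k) v) v.
have h := @sqrt_iter_bound _ _ _ (fun k => op pi (Qsum k)) op_Qsum0 op_QsumS op_Xsum_le k v.
have /andP[q0 q1] := qscal_itv (R := R) k.
have := rnorm_ge0 v; have := rnorm_ge0 (op pi (Qsum k) v).
move=> Q0 v0 CS; have := ler_norm (ip (op pi (Qsum k) v) v); nra.
Qed.

End Operators.

(** The differences are those of [Qsum], bounded by the scalar sequence in every representation at
    once, as the supremum in [cstar_norm] requires. *)
Lemma Asum_cauchy (e : R) : 0 < e -> exists N : nat, forall m k, (N <= m)%N -> (N <= k)%N ->
  (cstar_norm (fun s => fn (Asum m) s - fn (Asum k) s)%R < e%:E)%E.
Proof.
move=> e0; have [N qN] := qscal_cauchy e0; exists N => m k Nm Nk.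
apply: (@le_lt_trans _ _ `|qscal m - qscal k|%:E); last by rewrite lte_fin qN.
apply: ge_ereal_sup => _ [H [pi ->]].
have -> : (fun s => fn (Asum m) s - fn (Asum k) s) =
    fn (Qsum k ++ scale_sum (-1) (Qsum m)).
  apply/funext => s; rewrite !fn_cat !fn_scale rmorphN !mulN1r.
  by rewrite [X in X - _ = _]addrC addrKA opprK addrC.
apply: opnorm_le => // x; rewrite op_cat op_scale rmorphN scaleN1r distrC.
exact: op_Qsum_dist.
Qed.

Definition spectral_element : cstar G := Cstar (fun k => lp1_fn (Asum k)) Asum_cauchy.

Lemma pairing_spectral_element0 (H : hilbert R) (pi : unitary_rep G H) (rho : R) x v :
  0 <= rho -> rho < c -> (forall x, rnorm (op pi (avg y) x) <= rho * rnorm x) ->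
  pairing (coef pi x v) spectral_element = 0.
Proof.
move=> rho0 rhoc Trho; rewrite /pairing /=.
under eq_fun do rewrite pairing_l1_fn.
have := cvg_inner (v := v) (op_Asum_cvg0 x rho0 rhoc Trho).
by rewrite linear0l => /cvg_lim; apply.
Qed.

Lemma pairing_spectral_element_neq0 (H : hilbert R) (pi : unitary_rep G H) v :
  c * rnorm v < rnorm (op pi (avg y) v) -> pairing (coef pi v v) spectral_element <> 0.
Proof.
move=> Tv; rewrite /pairing /=; under eq_fun do rewrite pairing_l1_fn.
have [|w uw] := @cauchy_rnorm R H (fun k => op pi (Asum k) v).
  move=> e e0; have v1 : 0 < rnorm v + 1 by rewrite ltr_wpDl ?rnorm_ge0.
  have [N qN] := qscal_cauchy (divr_gt0 e0 v1); exists N => k Nk.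
  rewrite !op_cat [X in rnorm (X - _)]addrC addrKA !op_scale rmorphN !scaleN1r opprK addrC.
  rewrite (le_lt_trans (op_Qsum_dist pi k N v))//.
  have := qN k N Nk (leqnn N); rewrite ltr_pdivlMr//; apply: le_lt_trans.
  by rewrite ler_wpM2l// lerDl.
rewrite (cvg_lim _ (cvg_inner uw))// => wv0.
set g := (rnorm (op pi (avg y) v) ^+ 2 - c ^+ 2 * rnorm v ^+ 2) / 2.
have g0 : 0 < g.
  by rewrite divr_gt0// subr_gt0 -exprMn ltrXn2r// ?nnegrE ?rnorm_ge0// mulr_ge0// rnorm_ge0.
have v1 : 0 < rnorm v + 1 by rewrite ltr_wpDl ?rnorm_ge0.
(* At this precision the Cauchy-Schwarz error stays below [g], so a zero limit contradicts
   [ip_Asum_ge]. *)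
have [N _ wN] := uw _ (divr_gt0 g0 v1).
have := wN N (leqnn N); rewrite /= ltr_pdivlMr// mulrDr mulr1 => wu.
have := ip_Asum_ge pi N v; rewrite -/g.
have := ip_CauchySchwarz (w - op pi (Asum N) v) v.
rewrite ipDl ipNl [ip w v]/(complex.Re (inner H w v)) wv0 sub0r normrN => h1.
have := ler_norm (ip (op pi (Asum N) v) v).
have := rnorm_ge0 (w - op pi (Asum N) v); lra.
Qed.

End SpectralElement.

(** * Bessel's inequality and the canonical basis of l^2 *)

Lemma innerC (R : realType) (H : hilbert R) (x z : H) :
  inner H x z = Num.conj (inner H z x).
Proof. by rewrite hermC expr0 mul1r. Qed.

Section Orthonormal.
Context {R : realType} (H : hilbert R) (G : choiceType) (e : G -> H).
Hypothesis e_on : forall s t, inner H (e s) (e t) = (s == t)%:R.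
Implicit Types (f : H) (J : seq G).

Lemma Im_inner (x z : H) : complex.Im (inner H x z) = ip x ('i%C *: z).
Proof. by rewrite /ip linearZr_LR /=; case: (inner H x z) => u v /=; ring. Qed.

Lemma sqr_rnorm_proj f J : uniq J ->
  rnorm (f - \sum_(s <- J) inner H f (e s) *: e s) ^+ 2 =
  rnorm f ^+ 2 - \sum_(s <- J) sqc (inner H f (e s)).
Proof.
move=> uJ; set g := \sum_(s <- J) _; set S := \sum_(s <- J) _.
have mulcj (z : R[i]) : complex.Re (z * Num.conj z) = sqc z.
  by case: z => a b; rewrite /sqc/=; ring.
have fg : ip f g = S.
  rewrite ipC ip_suml; apply: eq_bigr => s _; rewrite ipC /ip linearZr_LR/=.
  by rewrite mulrC mulcj.
have eg s : s \in J -> inner H (e s) g = Num.conj (inner H f (e s)).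
  move=> sJ; rewrite /g linear_sumr (bigD1_seq s)//= linearZr_LR/= e_on eqxx mulr1.
  rewrite big1 ?addr0// => t ts; rewrite linearZr_LR/= e_on.
  by rewrite eq_sym (negPf ts) mulr0.
have gg : ip g g = S.
  rewrite {1}/g ip_suml big_seq [RHS]big_seq; apply: eq_bigr => s sJ.
  by rewrite /ip linearZl_LR/= eg// mulcj.
by rewrite sqr_rnormB fg -(ipxx g) gg; ring.
Qed.

Lemma Bessel f : sums_le (fun s => sqc (inner H f (e s))) (rnorm f ^+ 2).
Proof. by move=> J uJ; rewrite -subr_ge0 -sqr_rnorm_proj// sqr_ge0. Qed.

End Orthonormal.

Section Delta.
Context {R : realType} {I : choiceType}.
Local Notation E := (ell2_hilbert R I).

Lemma rnorm_ell2 (f : ell2 R I) : rnorm (f : E) ^+ 2 = nsq f.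
Proof. by rewrite -[rnorm _]/(Num.sqrt (nsq f)) sqr_sqrtr// nsq_ge0. Qed.

Fact delta_sqsum (s : I) : (fun t => (t == s)%:R : R[i]) \in (@sqsum R I).
Proof.
apply/asboolP; exists 1 => J uJ.
have [sJ|sJ] := boolP (s \in J).
  rewrite (bigD1_seq s)//= eqxx /sqc/= expr1n expr0n addr0 big1 ?addr0// => t ts.
  by rewrite (negPf ts)/= expr0n addr0.
rewrite big_seq big1// => t tJ; rewrite /sqc.
by have /negPf -> /= : t != s; [apply: contraNneq sJ => <-|rewrite expr0n addr0].
Qed.

Definition delta (s : I) : ell2 R I := Ell2 (delta_sqsum s).

Lemma inner_delta (f : ell2 R I) s : inner E f (delta s) = f s.
Proof.
have part (h : R[i] -> R) : h 0 = 0 ->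
    lim (partial_sum (fun i => h (f i * (delta s i)^*%C)) @ totally) = h (f s).
  move=> h0; apply: lim_near_cst => //; exists [fset s]%fset => // A sA.
  have sA' : s \in A by rewrite -fsub1set.
  rewrite /= /partial_sum (bigD1 [` sA']%fset)//= eqxx conjc1 mulr1 big1 ?addr0// => i is_.
  rewrite (_ : val i == s = false) ?conjc0 ?mulr0//.
  by apply: contraNF is_ => /eqP e; apply/eqP/val_inj.
have := part (@complex.Re R) erefl; have := part (@complex.Im R) erefl.
rewrite (cvg_lim _ (@cvg_rip _ _ f (delta s)))// (cvg_lim _ (@cvg_iip _ _ f (delta s)))//.
by move=> eI eR; rewrite /= /ell2_inner eI eR; case: (f s).
Qed.

Lemma delta_on s t : inner E (delta s) (delta t) = (s == t)%:R.
Proof. by rewrite inner_delta eq_sym. Qed.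

Lemma delta_span_dense (f : E) (a : R) : 0 < a ->
  exists J : seq I, rnorm (f - \sum_(s <- J) (f : ell2 R I) s *: (delta s : E)) < a.
Proof.
move=> a0; have a20 : 0 < a ^+ 2 by rewrite exprn_gt0.
have hs : has_sup [set \sum_(i <- s) sqc ((f : ell2 R I) i) | s in [set s | uniq s]].
  split; first by exists 0; exists [::] => //; rewrite big_nil.
  by exists (nsq f) => _ [t ut <-]; exact: (ell2_sums f).
(* A finite set that carries all but [a ^+ 2] of the squared norm. *)
have [_ [J uJ <-] Jf] := sup_adherent a20 hs.
exists J; rewrite -(@ltr_pXn2r _ 2) ?nnegrE ?rnorm_ge0 ?(ltW a0)//.
have := sqr_rnorm_proj delta_on f uJ.
under eq_bigr do rewrite inner_delta.
move=> ->; rewrite rnorm_ell2 ltrBlDr addrC -ltrBlDr.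
by under eq_bigr do rewrite inner_delta.
Qed.

End Delta.

(** * The kernel r^|x| *)

Section TreeKernel.
Context {R : realType} {G : groupType} {n : nat} (y : letter n -> G) (r : R).
Hypothesis yV : forall l, y (linv l) = (y l)^-1%g.
Hypothesis ev_inj : {in @reduced n &, injective (ev y)}.
Hypotheses (r0 : 0 < r) (r1 : r < 1).

Local Notation E := (ell2_hilbert R G).
Local Notation hw := (height_word y).
Implicit Types (s t x : G) (l : letter n) (z : seq (letter n)).

Definition word (x : G) : seq (letter n) :=
  xget [::] [set z | reduced z /\ x = ev y z].

Definition kernel (x : G) : R := if `[< orbit y 1%g x >] then r ^+ size (word x) else 0.

Lemma orbit1E x : orbit y 1%g x -> exists2 z, reduced z & x = ev y z.
Proof. by case=> z zP ->; exists z; rewrite ?mulg1. Qed.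

Lemma wordK z : reduced z -> word (ev y z) = z.
Proof.
move=> zP; rewrite /word; case: xgetP => [z' _ [z'P e]|/(_ z)[]]//.
exact/esym/ev_inj.
Qed.

Lemma kernel_ev z : reduced z -> kernel (ev y z) = r ^+ size z.
Proof.
move=> zP; rewrite /kernel wordK// ifT//; apply/asboolP; exists z => //.
by rewrite mulg1.
Qed.

Lemma kernel_out x : ~ orbit y 1%g x -> kernel x = 0.
Proof. by move=> xN; rewrite /kernel ifF//; apply/negP => /asboolP. Qed.

Lemma kernel1 : kernel 1%g = 1.
Proof. by rewrite -[1%g]/(ev y [::]) kernel_ev. Qed.

(** Inverting a reduced word cannot lengthen it, and inverting twice returns to [z] by freeness, so
    the length is preserved. *)
Lemma ev_inv_size z : reduced z ->
  exists z', [/\ reduced z', ev y z' = (ev y z)^-1%g & size z' = size z].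
Proof.
have half w : reduced w ->
    exists z', [/\ reduced z', ev y z' = (ev y w)^-1%g & (size z' <= size w)%N].
  elim: w => [|l w IH] wP; first by exists [::]; rewrite /= invg1.
  have [z' [z'P z'E z's]] := IH (path_sorted wP).
  exists (foldr push (push (linv l) [::]) z'); split.
  - by apply: foldr_push_reduced; apply: push_reduced.
  - by rewrite ev_foldr_push// ev_push// z'E /= mulg1 yV -invgM.
  - apply: (@leq_trans (size z').+1) => //.
    elim: z' {z'P z'E z's} => //= a z' IHz.
    exact: leq_trans (size_push _ _) _.
move=> zP; have [z' [z'P z'E z's]] := half z zP.
have [z2 [z2P z2E z2s]] := half z' z'P.
exists z'; split=> //; apply/eqP; rewrite eqn_leq z's/=.
have <- : z2 = z by apply: ev_inj; rewrite // z2E z'E invgK.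
exact: z2s.
Qed.

Lemma kernelV x : kernel x^-1%g = kernel x.
Proof.
have in_orbit t : orbit y 1%g t -> orbit y 1%g t^-1%g.
  move=> /orbit1E[z zP ->]; have [z' [z'P <- _]] := ev_inv_size zP.
  by exists z'; rewrite ?mulg1.
have [xP|xN] := pselect (orbit y 1%g x); last first.
  by rewrite !kernel_out// => /in_orbit; rewrite invgK.
have [z zP ->] := orbit1E xP; have [z' [z'P <- e]] := ev_inv_size zP.
by rewrite !kernel_ev// e.
Qed.

(** A Markov property: the path from [t] to [s] arrives through the parent of [s], because [s] is
    not lower than [t]. In words, [s * t^-1] begins with the first letter of [hw s]; the
    alternative, complete cancellation, would make [t] strictly higher. *)
Lemma kernel_parent s t l w : hw s = l :: w -> s <> t -> (size (hw t) <= size (hw s))%N ->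
  kernel (s * t^-1)%g = r * kernel (y (linv l) * s * t^-1)%g.
Proof.
move=> hs st hts; rewrite -mulgA; set x := (s * t^-1)%g.
have [xP|xN] := pselect (orbit y 1%g x); last first.
  rewrite !kernel_out ?mulr0// => xP; apply: xN.
  have [z zP e] := orbit1E xP; exists (push l z); first exact: push_reduced.
  by rewrite mulg1 ev_push// -e yV mulVKg.
have [z zP e] := orbit1E xP.
case: z => [|l1 z] in zP e *.
  by case: st; rewrite -[s](mulgK t^-1%g) -/x e /= mul1g invgK.
have hwz : hw s = foldr push (hw t) (l1 :: z).
  have -> : s = (ev y (l1 :: z) * t)%g by rewrite -e /x mulgVK.
  elim: (l1 :: z) => [|a u IH] /=; first by rewrite mul1g.
  by rewrite -mulgA height_word_mul// IH.
have [] := ohead_foldr_push (hw t) zP; rewrite -hwz hs.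
  case=> ll1; rewrite -{}ll1 in zP e hwz; rewrite e kernel_ev//.
  rewrite (_ : (y (linv l) * ev y (l :: z))%g = ev y z); last by rewrite yV /= mulKg.
  by rewrite kernel_ev ?exprS//; exact: path_sorted zP.
by move=> sz; move: hts; rewrite -sz hs addnS ltnNge leq_addr.
Qed.

(** Since [r ^+ 2 + kappa ^+ 2 = 1], the recursion for [vec] preserves unit length. *)
Let kappa : R := Num.sqrt (1 - r ^+ 2).

Let kappa2 : kappa ^+ 2 = 1 - r ^+ 2.
Proof. by rewrite sqr_sqrtr// subr_ge0 expr_le1// ltW. Qed.

Let kappa_neq0 : kappa != 0.
Proof. by rewrite sqrtr_eq0 -ltNge subr_gt0 expr_lt1// ltW. Qed.

(* The vectors [vec s] satisfy the recursion of a Gaussian Markov field on the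
   tree, which gives them the Gram matrix [kernel (s t^-1)]. *)
Fixpoint vec_rec (k : nat) (s : G) : E :=
  if k is k'.+1 then
    if hw s is l :: _ then r%:C%C *: vec_rec k' (y (linv l) * s)%g + kappa%:C%C *: (delta s : E)
    else delta s
  else delta s.

Definition vec s : E := vec_rec (size (hw s)) s.

Lemma hw_parent s l w : hw s = l :: w -> hw (y (linv l) * s)%g = w.
Proof. by move=> hs; rewrite height_word_mul// hs /= linvK eqxx. Qed.

Lemma vec_root s : hw s = [::] -> vec s = delta s.
Proof. by rewrite /vec => ->. Qed.

Lemma vec_parent s l w : hw s = l :: w ->
  vec s = r%:C%C *: vec (y (linv l) * s)%g + kappa%:C%C *: (delta s : E).
Proof. by move=> hs; rewrite /vec (hw_parent hs) hs /= hs. Qed.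

(** [vec t] is a combination of the [delta] at the vertices between the root and [t]; [s] is none of
    them, being distinct from [t] and not lower. *)
Lemma inner_delta_vec s t : s <> t -> (size (hw t) <= size (hw s))%N ->
  inner E (delta s) (vec t) = 0.
Proof.
move=> + ht; have [k] := ubnP (size (hw t)); elim: k => // k IH in t ht * => htk st.
case ht' : (hw t) => [|l w].
  by rewrite vec_root// delta_on; case: eqP.
have hp := hw_parent ht'.
rewrite (vec_parent ht') linearDr !linearZr_LR/= delta_on IH.
- by case: eqP => // _; rewrite !mulr0 addr0.
- by rewrite hp (leq_trans _ ht)// ht'.
- by rewrite hp -ltnS (leq_trans _ htk)// ht'.
by move=> e; move: ht; rewrite ht' e hp ltnn.
Qed.

Lemma inner_vec s t : inner E (vec s) (vec t) = (kernel (s * t^-1)%g)%:C%C.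
Proof.
have [k] := ubnP (size (hw s) + size (hw t)).
elim: k => // k IH in s t * => hk.
wlog hts : s t hk / (size (hw t) <= size (hw s))%N => [hwlog|].
  case/orP: (leq_total (size (hw t)) (size (hw s))) => [|hst]; first exact: hwlog.
  rewrite innerC hwlog//; last by rewrite addnC.
  by rewrite -[in RHS]kernelV invgM invgK [LHS]conjc_real.
case hs : (hw s) => [|l w].
  have ht : hw t = [::] by move: hts; rewrite hs; case: (hw t).
  rewrite !vec_root// delta_on; case: eqP => [->|st]; first by rewrite mulgV kernel1.
  (* Two distinct roots lie in different orbits. *)
  rewrite kernel_out// => /orbit1E[z zP e].
  have : hw s = z.
    have -> : s = (ev y z * t)%g by rewrite -e mulgVK.
    rewrite -[RHS](push_nil zP) -ht.
    elim: {zP e} z => [|a u IHu] /=; first by rewrite mul1g.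
    by rewrite -mulgA height_word_mul// IHu.
  rewrite hs => z0; apply: st; move: e; rewrite -z0 /= => e.
  by rewrite -[s](mulgVK t) e mul1g.
have hp := hw_parent hs.
have [st|st] := pselect (s = t); last first.
  (* The innovation [delta s] is orthogonal to [vec t], which leaves [r] times the inner product at
     the parent, as in [kernel_parent]. *)
  rewrite (vec_parent hs) linearDl !linearZl_LR/= inner_delta_vec// mulr0 addr0 IH.
    by rewrite (kernel_parent hs)// rmorphM.
  by rewrite hp -ltnS (leq_trans _ hk)// hs.
rewrite -st mulgV kernel1 (vec_parent hs).
set p := (y (linv l) * s)%g; have pp : inner E (vec p) (vec p) = 1.
  rewrite IH ?mulgV ?kernel1// hp -ltnS (leq_trans _ hk)// -st hs /= addSn ltnS addnS.
  by rewrite leqnSn.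
have sp : inner E (delta s) (vec p) = 0.
  apply: inner_delta_vec; rewrite ?hp ?hs// => e.
  by have := hp; rewrite -/p -e hs => /(congr1 size)/= /esym; exact: n_Sn.
have ps : inner E (vec p) (delta s) = 0.
  by rewrite innerC sp rmorph0.
rewrite linearDl !linearDr !linearZl_LR !linearZr_LR/= pp sp ps delta_on eqxx.
rewrite !mulr0 addr0 add0r !mulr1.
have cj (a : R) : Num.conj (a%:C%C : R[i]) = a%:C%C by exact: conjc_real.
by rewrite !cj -!rmorphM -rmorphD/= -!expr2 kappa2 addrC subrK.
Qed.

End TreeKernel.

(** * The representation with coefficient r^|x| *)

Section TreeRepresentation.
Context {R : realType} {G : groupType} {n : nat} (y : letter n -> G) (r : R).
Hypothesis yV : forall l, y (linv l) = (y l)^-1%g.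
Hypothesis ev_inj : {in @reduced n &, injective (ev y)}.
Hypotheses (r0 : 0 < r) (r1 : r < 1).

Local Notation E := (ell2_hilbert R G).
Local Notation hw := (height_word y).
Local Notation K := (kernel y r).
Local Notation vec := (@vec R G n y r).
Implicit Types (s t x : G) (f g : ell2 R G).

Let kappa : R := Num.sqrt (1 - r ^+ 2).

Let kappa_neq0 : kappa != 0.
Proof. by rewrite sqrtr_eq0 -ltNge subr_gt0 expr_lt1// ltW. Qed.

(* By [frame1] and [inner_frame], [frame t s] is the image of [delta s] under the
   map [vec x -> vec (x * t)], the adjoint of [translate t]. *)
Let delta_coefs s : seq (R * G) :=
  if hw s is l :: _ then [:: (kappa^-1, s); (- (kappa^-1 * r), (y (linv l) * s)%g)]
  else [:: (1, s)].

Let frame t s : E := \sum_(d <- delta_coefs s) d.1%:C%C *: vec (d.2 * t)%g.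

Let frame1 s : frame 1%g s = delta s.
Proof.
rewrite /frame /delta_coefs; case hs: (hw s) => [|l w].
  by rewrite big_seq1 mulg1 scale1r vec_root.
rewrite big_cons big_seq1 !mulg1 /= (vec_parent r yV ev_inj hs) scalerDr !scalerA -!rmorphM/=.
rewrite mulVf// scale1r addrAC -scalerDl -rmorphD/= subrr scale0r add0r.
by [].
Qed.

(** The Gram matrix depends on [s * t^-1] only, so right translation preserves it. This carries
    orthonormality from the basis [delta], the frame at 1, to every [frame t]. *)
Let inner_frame t s t' s' u :
  inner E (frame (t * u)%g s) (frame (t' * u)%g s') = inner E (frame t s) (frame t' s').
Proof.
rewrite /frame !linear_sumlz; apply: eq_bigr => d _; rewrite !linear_sumr.
apply: eq_bigr => d' _; rewrite !linearZl_LR !linearZr_LR/= !inner_vec//.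
by congr (_ * (_ * (K _)%:C%C)); rewrite !mulgA mulgKA.
Qed.

Let frame_on t s s' : inner E (frame t s) (frame t s') = (s == s')%:R.
Proof. by rewrite -[t]mul1g inner_frame !frame1 delta_on. Qed.

Let translate_sqsum t f : (fun s => inner E f (frame t s)) \in (@sqsum R G).
Proof. by apply/asboolP; exists (rnorm (f : E) ^+ 2); exact: Bessel (frame_on t) f. Qed.

Definition translate t f : ell2 R G := Ell2 (translate_sqsum t f).

Lemma translate_linear t : linear (translate t).
Proof.
move=> a f g; apply/val_inj/funext => s /=.
have -> : inner E (a *: f + g) (frame t s) = a * inner E f (frame t s) + inner E g (frame t s).
  by rewrite linearDl linearZl_LR.
by [].
Qed.

HB.instance Definition _ t := GRing.isLinear.Build R[i] (ell2 R G) (ell2 R G) *:%R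
  (translate t) (translate_linear t).

Lemma translate_le t (f : E) : rnorm (translate t f : E) <= rnorm f.
Proof.
rewrite -(@ler_pXn2r _ 2) ?nnegrE ?rnorm_ge0// rnorm_ell2.
by apply: nsq_le; exact: Bessel (frame_on t) f.
Qed.

Lemma translate_vec t x : translate t (vec x) = vec (x * t^-1)%g.
Proof.
apply/val_inj/funext => s /=.
rewrite -[RHS]/((vec (x * t^-1)%g : ell2 R G) s) -inner_delta -frame1.
rewrite /frame !linear_sumr; apply: eq_bigr => d _.
rewrite !linearZr_LR/= !inner_vec//; congr (_ * (K _)%:C%C).
by rewrite mulg1 invgM mulgA.
Qed.

Definition span_vec : set E :=
  [set f | exists D : seq (R[i] * G), f = \sum_(d <- D) d.1 *: vec d.2].

Lemma span_vec_lin (a : R[i]) (f g : E) : span_vec f -> span_vec g -> span_vec (a *: f + g).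
Proof.
move=> [D ->] [D' ->]; exists ([seq (a * d.1, d.2) | d <- D] ++ D').
rewrite big_cat big_map scaler_sumr; congr (_ + _).
by apply: eq_bigr => d _; rewrite scalerA.
Qed.

Lemma span_vec0 : span_vec 0.
Proof. by exists [::]; rewrite big_nil. Qed.

(** Each [delta s] is itself a combination of one or two of the [vec]. *)
Lemma span_vec_dense (f : E) (e : R) : 0 < e -> exists2 g, span_vec g & rnorm (f - g) < e.
Proof.
move=> e0; have [J fJ] := delta_span_dense f e0; eexists; last exact: fJ.
elim: J {fJ} => [|s J IH]; first by rewrite big_nil; exact: span_vec0.
rewrite big_cons; apply: span_vec_lin => //.
rewrite -frame1 /frame; exists [seq (d.1%:C%C, d.2) | d <- delta_coefs s].
by rewrite big_map; apply: eq_bigr => d _; rewrite mulg1.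
Qed.

(** Bessel's inequality makes [translate t] a contraction before unitarity is known. This suffices
    to check the group law on the [vec s], and unitarity then follows from the group law. *)
Lemma eq_on_vec (A B : {linear ell2 R G -> ell2 R G}) :
  (forall f : E, rnorm (A f : E) <= rnorm f) -> (forall f : E, rnorm (B f : E) <= rnorm f) ->
  (forall s, A (vec s) = B (vec s)) -> A =1 B.
Proof.
move=> A1 B1 AB f; apply/subr0_eq; apply: (@rnorm_eq0 _ E); apply/eqP.
rewrite eq_le rnorm_ge0 andbT; apply/ler_addgt0Pr => e e0; rewrite add0r.
have [g [D gE] fg] := span_vec_dense f (divr_gt0 e0 (ltr0n _ 2)).
have ABg : A g = B g.
  by rewrite gE !linear_sum; apply: eq_bigr => d _; rewrite !linearZ/= AB.
have -> : A f - B f = A (f - g) - B (f - g).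
  have Afg : A (f - g) = A f - A g := linearB A f g.
  have Bfg : B (f - g) = B f - B g := linearB B f g.
  by rewrite Afg Bfg ABg opprB addrA subrK.
have := A1 (f - g); have := B1 (f - g).
have := @ler_rnormB _ E (A (f - g)) (B (f - g)); lra.
Qed.

Lemma translate1 f : translate 1%g f = f.
Proof. by apply/val_inj/funext => s /=; rewrite frame1 inner_delta. Qed.

Lemma translateM s t f : translate (s * t)%g f = translate s (translate t f).
Proof.
apply: (@eq_on_vec (translate (s * t)%g) (translate s \o translate t)) => [g|g|x].
- exact: translate_le.
- exact: le_trans (translate_le _ _) (translate_le _ _).
by rewrite /= !translate_vec invgM mulgA.
Qed.

Lemma translate_isometry t (f : E) : rnorm (translate t f : E) = rnorm f.
Proof.
apply/eqP; rewrite eq_le translate_le/=.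
have := translate_le t^-1%g (translate t f).
by rewrite -translateM mulVg translate1.
Qed.

Lemma translate_unitary t (f g : E) :
  inner E (translate t f : E) (translate t g : E) = inner E f g.
Proof.
have ipE (u v : E) : ip (translate t u : E) (translate t v : E) = ip u v.
  have := sqr_rnormD (translate t u : E) (translate t v : E).
  rewrite -[(translate t u : E) + _](linearD (translate t)) !translate_isometry sqr_rnormD.
  lra.
apply/eqP; rewrite eq_complex; apply/andP; split; apply/eqP; first exact: ipE.
have iE : translate t ('i%C *: g) = 'i%C *: translate t g by rewrite linearZ.
by rewrite !Im_inner -[RHS]ipE iE.
Qed.

Definition tree_rep : unitary_rep G E :=
  @UnitaryRep R G E (fun t => translate t : {linear E -> E})
    translate1 translateM translate_unitary.

Lemma coef_tree_rep x z s : coef tree_rep (vec x) (vec z) s = (K (x * s^-1 * z^-1)%g)%:C%C.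
Proof. by rewrite /coef /= translate_vec inner_vec. Qed.

(** Each [y l] is a reduced word of length one, so [ip (T v) v] equals [r] at the unit vector
    [v = vec 1]. *)
Lemma tree_rep_avg_ge : r <= rnorm (op tree_rep (avg y) (vec 1%g)).
Proof.
have v1 : rnorm (vec 1%g) = 1.
  apply/eqP; rewrite -(@eqrXn2 _ 2) ?rnorm_ge0// -ipxx /ip inner_vec//.
  by rewrite mulgV kernel1//= expr1n.
have := ip_CauchySchwarz (op tree_rep (avg y) (vec 1%g)) (vec 1%g).
rewrite v1 mulr1; apply: le_trans; rewrite (le_trans _ (ler_norm _))//.
rewrite op_avg ipZl ip_suml ler_pdivlMl ?letter_gt0//.
rewrite (eq_bigr (fun=> r)) ?sumr_const ?mulr_natl// => l _.
rewrite /ip -[inner _ _ _]/(coef tree_rep (vec 1%g) (vec 1%g) (y l)) coef_tree_rep/=.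
rewrite mul1g invg1 mulg1 kernelV//.
have -> : y l = ev y [:: l] by rewrite /= mulg1.
by rewrite kernel_ev// expr1.
Qed.

End TreeRepresentation.

(** * Summability of r^|x| and of the coefficients of its representation *)

Section LpClosure.
Context {R : realType} {G : groupType} (q : R).
Hypothesis q1 : 1 < q.

Let q0 : 0 < q. Proof. exact: lt_trans q1. Qed.

Lemma lp0 : lp G q (fun=> 0).
Proof.
by apply/lpP; exists 0 => J _; rewrite big1// => s _; rewrite rnorm0 powR0 ?gt_eqF.
Qed.

Lemma lpD (f g : G -> R[i]) : lp G q f -> lp G q g -> lp G q (fun s => f s + g s).
Proof.
move=> /lpP[A fA] /lpP[B gB]; apply/lpP; exists (2 `^ (q - 1) * (A + B)).
apply: le_sums_le (sums_leZ (powR_ge0 _ _) (sums_leD fA gB)) => s.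
apply: le_trans (powR_add_le q1 (rnorm_ge0 _) (rnorm_ge0 _)).
by apply: ge0_ler_powR; rewrite ?nnegrE ?addr_ge0 ?rnorm_ge0 ?ler_rnormD// ltW.
Qed.

Lemma lpZ (a : R[i]) (f : G -> R[i]) : lp G q f -> lp G q (fun s => a * f s).
Proof.
move=> /lpP[A fA]; apply/lpP; exists (rnorm (a : R[i]^o) `^ q * A).
apply: le_sums_le (sums_leZ (powR_ge0 _ _) fA) => s.
rewrite -powRM ?rnorm_ge0//.
have -> : rnorm (a * f s : R[i]^o) = rnorm (a : R[i]^o) * rnorm (f s : R[i]^o).
  by apply: complexI; rewrite rmorphM/= !rnormE normrM.
by [].
Qed.

Lemma lp_sum (D : Type) (ds : seq D) (F : D -> G -> R[i]) :
  (forall d, lp G q (F d)) -> lp G q (fun s => \sum_(d <- ds) F d s).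
Proof.
move=> Fq; elim: ds => [|d ds IH].
  by under eq_fun do rewrite big_nil; exact: lp0.
by under eq_fun do rewrite big_cons; exact: lpD.
Qed.

End LpClosure.

Lemma sum_geometric_le (R : realType) (x : R) k : 0 <= x -> x < 1 ->
  \sum_(i < k) x ^+ i <= (1 - x)^-1.
Proof.
move=> x0 x1; rewrite -div1r ler_pdivlMr ?subr_gt0//.
have -> : (\sum_(i < k) x ^+ i) * (1 - x) = 1 - x ^+ k.
  elim: k => [|k IH]; first by rewrite big_ord0 mul0r subrr.
  by rewrite big_ord_recr/= mulrDl IH exprS; ring.
by rewrite gerBl exprn_ge0.
Qed.

(** There are [#|L| ^ k] words of length [k], whence a geometric series of ratio [#|L| * t]. *)
Lemma sum_words_le (R : realType) (L : finType) (t : R) (Z : seq (seq L)) :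
  0 <= t -> #|L|%:R * t < 1 -> uniq Z ->
  \sum_(z <- Z) t ^+ size z <= (1 - #|L|%:R * t)^-1.
Proof.
move=> t0 dt1 uZ; pose B := (\max_(z <- Z) size z).+1.
have zB z : z \in Z -> (size z < B)%N by move=> zZ; rewrite ltnS leq_bigmax_seq.
apply: le_trans (sum_geometric_le B _ dt1); last by rewrite mulr_ge0.
rewrite (eq_big_seq (fun z => \sum_(k < B | size z == k) t ^+ k)); last first.
  by move=> z /zB zk; rewrite (big_pred1 (Ordinal zk)).
rewrite (exchange_big_dep predT)//=; apply: ler_sum => k _.
rewrite -big_filter big_const_seq count_predT iter_addr_0 -[leLHS]mulr_natl exprMn -natrX.
rewrite ler_wpM2r ?exprn_ge0// ler_nat -card_tuple cardE.
rewrite -(size_map val); apply: uniq_leq_size; first exact: filter_uniq.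
move=> z; rewrite mem_filter => /andP[zk _].
by apply/mapP; exists (Tuple zk); rewrite ?mem_enum.
Qed.

Section TreeRepLp.
Context {R : realType} {G : groupType} {n : nat} (y : letter n -> G) (r q : R).
Hypothesis yV : forall l, y (linv l) = (y l)^-1%g.
Hypothesis ev_inj : {in @reduced n &, injective (ev y)}.
Hypotheses (r0 : 0 < r) (r1 : r < 1) (q1 : 1 < q).
Hypothesis drq : #|{: letter n}|%:R * r `^ q < 1.

Local Notation K := (kernel y r).

Lemma kernel_sums : sums_le (fun x => K x `^ q) (1 - #|{: letter n}|%:R * r `^ q)^-1.
Proof.
move=> J uJ; pose in_orbit x := `[< orbit y 1%g x >].
pose J' := [seq x <- J | in_orbit x].
have powXC k : (r ^+ k) `^ q = (r `^ q) ^+ k.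
  by rewrite -[RHS]powR_mulrn ?powR_ge0// powRAC powR_mulrn// ltW.
have -> : \sum_(x <- J) K x `^ q = \sum_(z <- map (word y) J') (r `^ q) ^+ size z.
  rewrite (bigID in_orbit)/= [X in _ + X]big1 ?addr0; last first.
    move=> x /asboolP xN; rewrite kernel_out// powR0//.
    by rewrite gt_eqF// (lt_trans _ q1).
  rewrite big_map big_filter; apply: eq_bigr => x xo.
  by rewrite /kernel -/(in_orbit x) xo powXC.
apply: sum_words_le => //; first exact: powR_ge0.
rewrite map_inj_in_uniq ?filter_uniq// => x x'.
rewrite !mem_filter => /andP[/asboolP/orbit1E[z zP ->] _] /andP[/asboolP/orbit1E[z' z'P ->] _].
by rewrite !wordK// => ->.
Qed.

(** On the span of the [vec], a diagonal coefficient is a finite combination of functions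
    [K (a * s^-1 * b)]. These are injective rearrangements of [K], so they inherit its
    summability. *)
Lemma tree_rep_lp : is_lp_rep q (tree_rep yV ev_inj r0 r1).
Proof.
exists (span_vec y r); split.
- exact: span_vec0.
- by move=> a f g; exact: span_vec_lin.
- move=> O [f Of] Oo.
  have /nbhs_ballP[e /= e0 eO] := open_nbhs_nbhs (conj Oo Of).
  have eE : (complex.Re e)%:C%C = e by rewrite RRe_real// gtr0_real.
  have e0' : 0 < complex.Re e by rewrite -ltcR eE.
  have [g gs fg] := span_vec_dense yV ev_inj r0 r1 f e0'.
  exists g; split=> //; apply: eO; rewrite -ball_normE/= -eE -rnormE ltcR.
  exact: fg.
move=> _ [D ->].
set f := \sum_(d <- D) _.
have -> : coef (tree_rep yV ev_inj r0 r1) f f = fun s =>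
    \sum_(d <- D) \sum_(d' <- D) (d.1 * Num.conj d'.1) * (K (d.2 * s^-1 * d'.2^-1)%g)%:C%C.
  apply/funext => s; rewrite /coef [X in inner _ X _](_ : _ =
    \sum_(d <- D) d.1 *: tree_rep yV ev_inj r0 r1 s (vec y r d.2)); last first.
    by rewrite /f linear_sum; apply: eq_bigr => d _; rewrite linearZ.
  rewrite linear_sumlz; apply: eq_bigr => d _; rewrite linear_sumr; apply: eq_bigr => d' _.
  by rewrite linearZl_LR linearZr_LR/= mulrA -(coef_tree_rep yV ev_inj r0 r1).
apply: lp_sum => // d; apply: lp_sum => // d'; apply: lpZ.
apply/lpP; exists (1 - #|{: letter n}|%:R * r `^ q)^-1.
apply: (@le_sums_le _ _ _ (fun s => K (d.2 * s^-1 * d'.2^-1)%g `^ q)) => [s|].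
  rewrite le_eqVlt; apply/orP; left; apply/eqP; congr (_ `^ q).
  have K0 : 0 <= K (d.2 * s^-1 * d'.2^-1)%g.
    by rewrite /kernel; case: ifP => // _; rewrite exprn_ge0// ltW.
  by rewrite /rnorm normc_def/= expr0n addr0 sqrtr_sqr ger0_norm.
apply: (@sums_le_inj _ _ _ (fun s => (d.2 * s^-1 * d'.2^-1)%g) (fun x => K x `^ q) _ _ kernel_sums).
by move=> s s' /mulIg/mulgI/invg_inj.
Qed.

End TreeRepLp.

(** * Choice of the rank and separation of the exponents *)

Lemma free_rank_choice (R : realType) (p q : R) : 2 <= p -> p < q ->
  exists n : nat, exists r c : R, let d := #|{: letter n}|%:R in
  [/\ 0 < r < 1, d * r `^ q < 1, 2 * d `^ (- p^-1) < c & c < r].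
Proof.
move=> p2 pq; have p0 : 0 < p by rewrite (lt_le_trans _ p2).
(* With [r = d ^ (- 1/m)], [m < q] gives [d * r ^ q = d ^ (1 - q/m) < 1], and [p < m] leaves room to
   beat the factor 2. *)
pose m : R := (p + q) / 2.
have pm : p < m by rewrite /m; lra.
have mq : m < q by rewrite /m; lra.
have m0 : 0 < m by exact: lt_trans pm.
pose b : R := p^-1 - m^-1.
have b0 : 0 < b by rewrite subr_gt0 ltf_pV2 ?posrE.
(* [rho < r] amounts to [2 < d ^ b], and [d = 2 (n + 2)] exceeds [n]. *)
pose n := Num.bound ((2 : R) `^ b^-1).
exists n; pose d : R := #|{: letter n}|%:R.
have d_big : 2 `^ b^-1 < d.
  apply: lt_le_trans (archi_boundP (powR_ge0 _ _)) _.
  rewrite ler_nat card_prod card_ord card_bool -/n.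
  by rewrite muln2 -addnn (leq_trans _ (leq_addr _ _))// -addn2 leq_addr.
have d1 : 1 < d by rewrite ltr1n card_prod card_ord card_bool.
have d0 : 0 < d by exact: lt_trans d1.
have dN0 : d != 0 by rewrite gt_eqF.
pose r : R := d `^ (- m^-1).
have rho_r : 2 * d `^ (- p^-1) < r.
  have -> : r = d `^ b * d `^ (- p^-1).
    by rewrite -powRD ?dN0 ?implybT// /b /r; congr (_ `^ _); ring.
  rewrite ltr_pM2r ?powR_gt0//.
  have -> : (2 : R) = (2 `^ b^-1) `^ b by rewrite -powRrM mulVf ?gt_eqF// powRr1.
  by rewrite gt0_ltr_powR// ?nnegrE ?powR_ge0// ltW.
have expr_lt1 (a : R) : a < 0 -> d `^ a < 1.
  move=> a0; rewrite -[a]opprK powRN invf_lt1 ?powR_gt0//.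
  have <- : (1 : R) `^ (- a) = 1 by rewrite powR1.
  by apply: gt0_ltr_powR; rewrite ?oppr_gt0 ?nnegrE ?ler01 ?(ltW d0).
exists r, ((2 * d `^ (- p^-1) + r) / 2) => /=; rewrite -/d; split.
- by rewrite powR_gt0//= expr_lt1// oppr_lt0 invr_gt0.
- rewrite /r -powRrM -[X in X * _](powRr1 (ltW d0)) -powRD ?dN0 ?implybT//.
  rewrite expr_lt1//; have : 1 < q / m by rewrite ltr_pdivlMr// mul1r.
  by rewrite mulNr mulrC; lra.
- by lra.
- by lra.
Qed.

Theorem proposition4p7 (R : realType) (Gamma : groupType)
    (hGamma : contains_noncommutative_free_group Gamma) :
  (forall p q : R, 2 <= p -> 2 <= q -> p <> q -> B_lp Gamma p <> B_lp Gamma q)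
  /\
  (forall p q : R, 2 <= p -> 2 <= q -> p <> q -> A_lp Gamma p <> A_lp Gamma q).
Proof.
have sep (p q : R) : 2 <= p -> p < q -> B_lp Gamma p <> B_lp Gamma q.
  move=> p2 pq BB; have [n [r [c [/andP[r0 r1] drq rhoc cr]]]] := free_rank_choice p2 pq.
  have [y [yV ev_inj]] := free_letters n hGamma.
  have q1 : 1 < q by rewrite (lt_trans _ pq)// (lt_le_trans _ p2)// ltr1n.
  pose pi := tree_rep yV ev_inj r0 r1; pose xi := vec y r 1%g.
  have rho0 : 0 <= 2 * #|{: letter n}|%:R `^ (- p^-1) :> R by rewrite mulr_ge0// powR_ge0.
  have c0 : 0 <= c by exact: le_trans (ltW rhoc).
  have c1 : c <= 1 by rewrite ltW// (lt_trans cr).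
  have uA : A_lp Gamma q (coef pi xi xi).
    by exists _, pi, xi, xi; split=> //; exact: tree_rep_lp.
  (* Equality would put this coefficient in the weak-star closure of [A_lp p], on which the spectral
     element vanishes. *)
  have : B_lp Gamma p (coef pi xi xi).
    rewrite BB; split; first by exists _, pi, xi, xi.
    exact: (subset_closure (uA : (A_lp Gamma q : set (weak_star Gamma)) _)).
  case=> _ /(@closure_pairing0 _ _ _ (spectral_element yV c0 c1)) pair0.
  apply: (@pairing_spectral_element_neq0 _ _ _ _ _ yV c0 c1 _ pi xi).
    (* [xi] is a unit vector, so [c < r] supplies the strict inequality. *)
    rewrite (lt_le_trans _ (tree_rep_avg_ge yV ev_inj r0 r1))//.
    have : rnorm xi ^+ 2 = 1 by rewrite -ipxx /ip inner_vec// mulgV kernel1.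
    move=> /eqP; rewrite sqrf_eq1 => /orP[/eqP ->|/eqP xiN]; first by rewrite mulr1.
    by have := rnorm_ge0 xi; rewrite xiN ler0N1.
  apply: pair0 => _ [H [sigma [x [v [sigma_lp ->]]]]].
  apply: (pairing_spectral_element0 yV c0 c1 _ _ rho0 rhoc).
  exact: lp_rep_avg_le.
have sepB (p q : R) : 2 <= p -> 2 <= q -> p <> q -> B_lp Gamma p <> B_lp Gamma q.
  move=> p2 q2 /eqP; rewrite neq_lt => /orP[pq|qp]; first exact: sep.
  by move=> /esym; exact: sep.
split=> // p q p2 q2 pq AA; apply: (sepB p q p2 q2 pq).
by rewrite /B_lp AA.
Qed.
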